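(* Let $\ell\ge4$ and let $q\in\mathbb{C}^\times$ be such that $q^2$ has multiplicative order $\ell$. The dimensions $\ell_i(n)$ ($0\le i\le\ell-2$) of the simple $Q_n(\ell)$-modules $L_i(n)$ are determined by the initial conditions $$\ell_i(\ell-1)=w_i(\ell-1)\ \text{ for } i\equiv \ell-1 \ (\mathrm{mod}\ 2),\qquad \ell_i(\ell-2)=w_i(\ell-2)\ \text{ for } i\equiv\ell\ (\mathrm{mod}\ 2),$$ together with the following recurrences, valid for positive integers $n$. If $\ell\ge6$ is even, then $$(\ell_0(n+2),\ell_2(n+2),\dots,\ell_{\ell-2}(n+2))^T=M_{11}\left(\tfrac{\ell}{2}\right)(\ell_0(n),\ell_2(n),\dots,\ell_{\ell-2}(n))^T,$$ $$(\ell_1(n+2),\ell_3(n+2),\dots,\ell_{\ell-3}(n+2))^T=M_{22}\left(\tfrac{\ell}{2}-1\right)(\ell_1(n),\ell_3(n),\dots,\ell_{\ell-3}(n))^T.$$ If $\ell\ge6$ is odd, then $$(\ell_0(n+2),\ell_2(n+2),\dots,\ell_{\ell-3}(n+2))^T=M_{12}\left(\tfrac{\ell-1}{2}\right)(\ell_0(n),\ell_2(n),\dots,\ell_{\ell-3}(n))^T,$$ $$(\ell_1(n+2),\ell_3(n+2),\dots,\ell_{\ell-2}(n+2))^T=M_{21}\left(\tfrac{\ell-1}{2}\right)(\ell_1(n),\ell_3(n),\dots,\ell_{\ell-2}(n))^T.$$ If $\ell=4$, the respective recurrence matrices for the vectors $(\ell_0,\ell_2)^T$ and $(\ell_1)$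 are $\begin{pmatrix}1&1\\1&1\end{pmatrix}$ and $\begin{pmatrix}2\end{pmatrix}$; if $\ell=5$, those for $(\ell_0,\ell_2)^T$ and $(\ell_1,\ell_3)^T$ are $\begin{pmatrix}1&1\\1&2\end{pmatrix}$ and $\begin{pmatrix}2&1\\1&1\end{pmatrix}$.
   Context: $TL_n(q)$ is the associative unital $\mathbb{C}$-algebra with generators $f_1,\dots,f_{n-1}$ and relations $f_i^2=-(q+q^{-1})f_i$, $f_if_{i\pm1}f_i=f_i$, $f_if_j=f_jf_i$ for $|i-j|\ge 2$. Equivalently it has as basis the Temperley-Lieb diagrams $n\to n$, multiplied by stacking, each closed loop being replaced by the scalar $-(q+q^{-1})$; $f_i$ is the diagram joining the top points $i,i+1$ and the bottom points $i,i+1$, all other strings being vertical. A Temperley-Lieb diagram $t\to n$ is a planar non-crossing perfect matching (up to isotopy) of $t$ bottom points and $n$ top points; it is monic if every bottom point is joined to a top point. $\mathcal{T}(n)=\{t\in\mathbb{Z}: 0\le t\le n,\ t\equiv n \bmod 2\}$. For $t\in\mathcal{T}(n)$, the cell module $W_t(n)$ has basis the monic diagrams $t\to n$; $TL_n(q)$ acts by stacking on top, non-monic results being set to zero. For monic $D_1,D_2:t\to n$, let $D_1^*$ be the reflection of $D_1$ in a horizontal line; put $D_1^*D_2=(D_1,D_2)\,\mathrm{id}_t$ if $D_1^*D_2$ is a multiple of $\mathrm{id}_t$, and $(D_1,D_2)=0$ otherwise. $L_t(n)$ is the quotient of $W_t(n)$ by the radical of this bilinear form; it is a simple $TL_n(q)$-module.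 $w_t(n):=\dim W_t(n)$ and $\ell_t(n):=\dim L_t(n)$, both taken to be $0$ if $t\notin\mathcal{T}(n)$. $E_{\ell-1}\in TL_{\ell-1}(q)$ is the unique non-zero idempotent with $f_iE_{\ell-1}=E_{\ell-1}f_i=0$ for $1\le i\le \ell-2$. For $n\ge\ell-1$, $TL_{\ell-1}(q)\subseteq TL_n(q)$ via $f_i\mapsto f_i$, and $Q_n(\ell)$ is the quotient of $TL_n(q)$ by the two-sided ideal generated by $E_{\ell-1}$; for $n<\ell-1$, $Q_n(\ell)=TL_n(q)$. The simple $Q_n(\ell)$-modules are the $L_t(n)$ with $t\in\mathcal{T}(n)$, $t\le \ell-2$. For $a,b\in\{1,2\}$ and $m\ge2$, $M_{ab}(m)$ is the $m\times m$ symmetric tridiagonal matrix whose entries immediately above and below the diagonal are all $1$, whose $(1,1)$ entry is $a$, whose $(m,m)$ entry is $b$, and whose other diagonal entries are all $2$. *)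

(* Defs.v *)
From HB Require Import structures.
From mathcomp Require Import all_boot all_order all_algebra.
From mathcomp Require Import reals.
From mathcomp Require Import complex.

Set Implicit Arguments.
Unset Strict Implicit.
Unset Printing Implicit Defensive.

Import GRing.Theory.
Local Open Scope ring_scope.

(* A wiring t -> n joins t bottom points [inl i] and n top points [inr j],
   both numbered from left to right.  Temperley-Lieb diagrams are the wirings
   satisfying [is_tl_diagram] below. *)
Definition point (t n : nat) : finType := ('I_t + 'I_n)%type.
Definition wiring (t n : nat) : finType := {ffun point t n -> point t n}.

(* Rank of a point when the boundary of the strip is read counterclockwise:
   bottom from left to right, then top from right to left. *)
Definition boundary_pos (t n : nat) (x : point t n) : nat :=
  match x with
  | inl i => i
  | inr j => (t + (n - j.+1))%N
  end.

Definition perfect_matching (t n : nat) (D : wiring t n) : bool :=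
  [forall x, (D x != x) && (D (D x) == x)].

Definition noncrossing (t n : nat) (D : wiring t n) : bool :=
  [forall x, forall y,
     ~~ [&& (boundary_pos x < boundary_pos y)%N,
            (boundary_pos y < boundary_pos (D x))%N
          & (boundary_pos (D x) < boundary_pos (D y))%N]].

Definition is_tl_diagram (t n : nat) (D : wiring t n) : bool :=
  perfect_matching D && noncrossing D.

Definition is_top (t n : nat) (x : point t n) : bool :=
  if x is inr _ then true else false.

Definition monic (t n : nat) (D : wiring t n) : bool :=
  [forall i : 'I_t, is_top (D (inl i))].

Definition monic_diagram (t n : nat) : finType :=
  {D : wiring t n | is_tl_diagram D && monic D}.

Definition id_wiring (t : nat) : wiring t t :=
  [ffun x : point t t => match x with
                         | inl i => inr i
                         | inr i => inl i
                         end].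

Definition swap (t n : nat) (x : point t n) : point n t :=
  match x with
  | inl i => inr i
  | inr j => inl j
  end.

Definition reflect_wiring (t n : nat) (D : wiring t n) : wiring n t :=
  [ffun x => swap (D (swap x))].

(* Stacking D' : n -> m on top of D : t -> n gives a graph on the outer points
   [inl x], x : point t m, and the middle points [inr k], where the top of D is
   glued to the bottom of D'. *)
Section Stacking.
Variables t n m : nat.

Definition stack_point : finType := (point t m + 'I_n)%type.

Definition lower_point (x : point t n) : stack_point :=
  match x with
  | inl i => inl (inl i)
  | inr k => inr k
  end.

Definition upper_point (x : point n m) : stack_point :=
  match x with
  | inl k => inr k
  | inr j => inl (inr j)
  end.

Variables (D' : wiring n m) (D : wiring t n).

Definition stack_edge : rel stack_point := fun u v =>
  [exists x, (u == lower_point x) && (v == lower_point (D x))]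
  || [exists x, (u == upper_point x) && (v == upper_point (D' x))].

(* If D and D' are perfect matchings, the component of an outer point contains
   exactly one other outer point, so the default value is never used. *)
Definition stack : wiring t m :=
  [ffun x : point t m =>
     odflt x [pick y | (y != x) && connect stack_edge (inl x) (inl y)]].

Definition closed_loops : nat :=
  n_comp stack_edge
    [pred u | ~~ [exists x : point t m, connect stack_edge u (inl x)]].

End Stacking.

Section CellModules.
Variables (F : fieldType) (q : F).

Definition loop_value : F := - (q + q^-1).

(* The scalar (D1, D2), determined by D1^* D2 = (D1, D2) id_t when the stacked
   diagram is the identity, and zero otherwise. *)
Definition pairing (t n : nat) (D1 D2 : wiring t n) : F :=
  if stack (reflect_wiring D1) D2 == id_wiring t
  then loop_value ^+ closed_loops (reflect_wiring D1) D2
  else 0.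

Definition cell_module (t n : nat) : vectType F :=
  {ffun monic_diagram t n -> F^o}.

Definition cell_form (t n : nat) (u v : cell_module t n) : F :=
  \sum_D1 \sum_D2 (u D1 : F) * (v D2 : F) * pairing (val D1) (val D2).

Definition basis_vector (t n : nat) (D : monic_diagram t n) :
    cell_module t n :=
  [ffun D' => ((D' == D)%:R : F^o)].

Definition form_map (t n : nat) (u : cell_module t n) : cell_module t n :=
  [ffun D => (cell_form u (basis_vector D) : F^o)].

Fact form_map_linear (t n : nat) : linear (@form_map t n).
Proof.
move=> a u v; apply/ffunP => D; rewrite !ffunE.
transitivity (a * cell_form u (basis_vector D)
              + cell_form v (basis_vector D)) => //.
rewrite /cell_form mulr_sumr -big_split; apply: eq_bigr => D1 _ /=.
rewrite mulr_sumr -big_split; apply: eq_bigr => D2 _ /=.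
by rewrite !ffunE !mulrDl !mulrA.
Qed.

HB.instance Definition _ (t n : nat) :=
  GRing.isLinear.Build F (cell_module t n) (cell_module t n) _
    (@form_map t n) (@form_map_linear t n).

(* Radical of the bilinear form, as a subspace; see [radicalP]. *)
Definition radical (t n : nat) : {vspace cell_module t n} :=
  lker (linfun (@form_map t n)).

Lemma radicalP (t n : nat) (u : cell_module t n) :
  reflect (forall v, cell_form u v = 0) (u \in radical t n).
Proof.
rewrite memv_ker lfunE /=; apply: (iffP eqP) => [u0 v | u0]; last first.
  by apply/ffunP => D; rewrite !ffunE u0.
have formE D : cell_form u (basis_vector D) =
    \sum_D1 (u D1 : F) * pairing (val D1) (val D).
  apply: eq_bigr => D1 _; rewrite (bigD1 D) //= big1 => [|D2 neqD].
    by rewrite ffunE eqxx mulr1 addr0.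
  by rewrite ffunE (negPf neqD) mulr0 mul0r.
rewrite /cell_form exchange_big /= big1 // => D _.
transitivity ((v D : F) * cell_form u (basis_vector D)).
  rewrite formE mulr_sumr; apply: eq_bigr => D1 _.
  by rewrite mulrCA mulrA.
by move/ffunP/(_ D): u0; rewrite !ffunE => ->; rewrite mulr0.
Qed.

(* t belongs to T(n) *)
Definition admissible (n t : nat) : bool := (t <= n)%N && (odd t == odd n).

Definition cell_dim (t n : nat) : nat :=
  if admissible n t then \dim {: cell_module t n} else 0.

(* dimension of L_t(n), the quotient of W_t(n) by the radical *)
Definition simple_dim (t n : nat) : nat :=
  if admissible n t then (\dim {: cell_module t n} - \dim (radical t n))%N
  else 0.

End CellModules.

Definition tridiag (a b : int) (m : nat) : 'M[int]_m :=
  \matrix_(i, j)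
    if i == j then
      if i == 0%N :> nat then a else if i.+1 == m then b else 2
    else if (i.+1 == j) || (j.+1 == i) then 1 else 0.

Definition matrix22 (a b c d : int) : 'M[int]_2 :=
  \matrix_(i, j)
    if i == 0 then (if j == 0 then a else b) else (if j == 0 then c else d).

(* In the following x i n stands for the i-th dimension at n. *)

(* (x_0(n), x_2(n), ..., x_(2m-2)(n))^T *)
Definition even_vector (x : nat -> nat -> int) (m n : nat) : 'cV[int]_m :=
  \col_i x i.*2 n.

(* (x_1(n), x_3(n), ..., x_(2m-1)(n))^T *)
Definition odd_vector (x : nat -> nat -> int) (m n : nat) : 'cV[int]_m :=
  \col_i x i.*2.+1 n.

Definition initial_conditions (ell : nat) (w x : nat -> nat -> int) : Prop :=
  (forall i, (i <= ell - 2)%N -> odd i = odd (ell - 1) ->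
     x i (ell - 1)%N = w i (ell - 1)%N) /\
  (forall i, (i <= ell - 2)%N -> odd i = odd ell ->
     x i (ell - 2)%N = w i (ell - 2)%N).

Definition recurrence (v : forall m, nat -> 'cV[int]_m) (m : nat)
    (M : 'M[int]_m) : Prop :=
  forall n, (0 < n)%N -> v m (n + 2)%N = M *m v m n.

Definition recurrences (ell : nat) (x : nat -> nat -> int) : Prop :=
  [/\ (6 <= ell)%N -> ~~ odd ell ->
        recurrence (even_vector x) (tridiag 1 1 ell./2) /\
        recurrence (odd_vector x) (tridiag 2 2 (ell./2 - 1)),
      (6 <= ell)%N -> odd ell ->
        recurrence (even_vector x) (tridiag 1 2 (ell - 1)./2) /\
        recurrence (odd_vector x) (tridiag 2 1 (ell - 1)./2),
      ell = 4%N ->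
        recurrence (even_vector x) (matrix22 1 1 1 1) /\
        recurrence (odd_vector x) (2%:M : 'M[int]_1)
    & ell = 5%N ->
        recurrence (even_vector x) (matrix22 1 1 1 2) /\
        recurrence (odd_vector x) (matrix22 2 1 1 1)].

(* Main.v *)
Require Import Defs.
From HB Require Import structures.
From mathcomp Require Import all_boot all_order all_algebra.
From mathcomp Require Import reals.
From mathcomp Require Import complex.
From mathcomp Require Import ring zify.

Set Implicit Arguments.
Unset Strict Implicit.
Unset Printing Implicit Defensive.

Import GRing.Theory VectorInternalTheory Num.Theory Num.Def.
Local Open Scope ring_scope.

(** Let r(t, n) be the rank of the form on the cell module W_t(n).  The theorem
    follows from the recursion
      r(t, n+1) = r(t-1, n) + [t+2 <> ell] r(t+1, n)   for t <= ell-2,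
    with r(-1, n) = 0 ([simple_dim_step]).  Two steps of it are one application
    of the square of the adjacency matrix of the path 0 - 1 - ... - (ell-2);
    restricted to the even or to the odd vertices, this square is tridiagonal
    with ones next to the diagonal and twos on it, except for a one at each end
    of the path.  The numbers of diagrams satisfy the same recursion without
    truncation, and as long as n <= ell-1 the truncated term counts diagrams
    with more bottom points than top points, so the form is non-degenerate
    there: these are the initial conditions ([simple_dim_full]).

    The recursion is proved in a tensor model.  Let V have the basis up, down
    and choose a with a^2 = -1/q.  Reading a cup as the vector
    a (up (x) down) + a^-1 (down (x) up) and a vertical string as the identity
    turns a diagram t -> n into a linear map from the t-th to the n-th tensor
    power of V.  Its value at up (x) ... (x) up is the state vector of the
    diagram.  The pairing of two monic diagrams is the dot product of their
    state vectors ([pairing_state_sum], [pairing_dot]): both sides are unchanged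
    when an innermost cup of one diagram is contracted against the other, up to
    a factor a^2 + a^-2 = -(q + 1/q) when a loop closes ([state_sum]).  This is
    the one place where planarity of pairs of diagrams is used.

    Hence r(t, n) is the rank of the dot product on the span H_t(n) of the
    state vectors.  The linear maps of diagrams commute with the raising and
    lowering operators of quantum sl2 ([tensor_raise], [tensor_lower]); so the
    raising operator E kills H_t(n), while the lowering operator F is its
    transpose.  Put [k] = (q^(2k) - 1) / (q^2 - 1), which vanishes exactly when
    ell divides k.  Splitting off the last tensor factor, and provided
    [t+1] <> 0, the space H_t(n+1) is the sum of H_(t-1)(n) (x) up and of the
    vectors h (x) down + gamma F h (x) up with h in H_(t+1)(n), where gamma =
    - q^(t+1) / [t+1] ([cell_span_step]).  The two summands are orthogonal,
    because E and F are transposes, and the commutator of E and F shows that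
    the second one carries the form of H_(t+1)(n) multiplied by [t+2] / [t+1].
    Taking ranks gives the recursion ([gram_rank_rec]). *)

(** * The quantum group operators on tensor powers *)

(** The dimension of the n-th tensor power of V, written so that splitting off the
    last factor is a definitional block decomposition; the first block is up. *)
Fixpoint spin_dim n : nat :=
  if n is n'.+1 then (spin_dim n' + spin_dim n')%N else 1%N.

Local Notation d := spin_dim.

Section TensorModel.
Variables (F : fieldType) (a q : F).
Hypotheses (a_neq0 : a != 0) (q_neq0 : q != 0) (aaq : a * a * q = -1).
Hypothesis q2_neq1 : q ^+ 2 != 1.

(** The operators K, E and F of quantum sl2 on row vectors.  The coproduct
    E (x) 1 + K (x) E has been chosen so that F is the transpose of E. *)
Fixpoint weight_op n : 'M[F]_(d n) :=
  if n is n'.+1 then block_mx (q *: weight_op n') 0 0 (q^-1 *: weight_op n') else 1%:M.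
Fixpoint raise n : 'M[F]_(d n) :=
  if n is n'.+1 then block_mx (raise n') 0 (weight_op n') (raise n') else 0.
Fixpoint lower n : 'M[F]_(d n) :=
  if n is n'.+1 then block_mx (lower n') (weight_op n') 0 (lower n') else 0.

Lemma weight_op_tr n : (weight_op n)^T = weight_op n.
Proof.
elim: n => [|n IH] /=; first by rewrite trmx1.
by rewrite (tr_block_mx (q *: weight_op n)) !linearZ /= IH !trmx0.
Qed.

Lemma raise_tr n : (raise n)^T = lower n.
Proof.
elim: n => [|n IH] /=; first by rewrite trmx0.
by rewrite (tr_block_mx (raise n)) IH weight_op_tr !trmx0.
Qed.

Lemma lower_tr n : (lower n)^T = raise n.
Proof. by rewrite -raise_tr trmxK. Qed.

Lemma raise_weight_op n : raise n *m weight_op n = q ^+ 2 *: (weight_op n *m raise n).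
Proof.
elim: n => [|n IH] /=; first by rewrite mul0mx mulmx0 scaler0.
rewrite !mulmx_block !mul0mx !mulmx0 !addr0 !add0r -!scalemxAl -!scalemxAr IH.
rewrite (scale_block_mx (q ^+ 2)) !scalerA !scaler0.
by congr (block_mx (_ *: _) _ (_ *: _) (_ *: _)); field.
Qed.

Lemma lower_weight_op n : weight_op n *m lower n = q ^+ 2 *: (lower n *m weight_op n).
Proof.
by rewrite -[LHS]trmxK trmx_mul -raise_tr trmxK weight_op_tr raise_weight_op linearZ /=
           trmx_mul weight_op_tr.
Qed.

(** The diagonal part of the q-commutator of E and F.  It equals the function
    (K^2 - 1) / (q^2 - 1) of K, and the recursive form is what the induction on n
    produces. *)
Fixpoint cartan n : 'M[F]_(d n) :=
  if n is n'.+1 then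
    block_mx (cartan n' + weight_op n' *m weight_op n') 0
             0 (cartan n' - q ^- 2 *: (weight_op n' *m weight_op n'))
  else 0.

Lemma lower_raise n :
  lower n *m raise n = q ^- 2 *: (raise n *m lower n) + cartan n.
Proof.
elim: n => [|n IH] /=; first by rewrite !mul0mx scaler0 addr0.
rewrite !mulmx_block !mul0mx !mulmx0 !addr0 !add0r raise_weight_op lower_weight_op IH.
rewrite (scale_block_mx (q ^- 2)) (add_block_mx (q ^- 2 *: _)).
rewrite scalerDr !scalerA mulVf ?expf_neq0 // !scale1r !addr0 addrA.
by congr block_mx; rewrite [RHS]addrC -addrA addKr addrC.
Qed.

Lemma cartan_weight_op n : (q ^+ 2 - 1) *: cartan n = weight_op n *m weight_op n - 1%:M.
Proof.
elim: n => [|n IH] /=; first by rewrite scaler0 mulmx1 subrr.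
rewrite (scale_block_mx (q ^+ 2 - 1)) mulmx_block !mul0mx !mulmx0 !addr0 !add0r.
rewrite [1%:M]scalar_mx_block opp_block_mx (add_block_mx (_ *m _)).
rewrite -!scalemxAl -!scalemxAr !scalerA !scalerBr scalerDr IH !scalerA.
rewrite scaler0 subr0.
have add_mul c (M N : 'M[F]_(d n)) : M - N + c *: M = (1 + c) *: M - N.
  by rewrite addrAC scalerDl scale1r.
by congr block_mx; rewrite -?scaleNr add_mul; congr (_ *: _ - _); field.
Qed.

(** The highest weight vector up (x) ... (x) up. *)
Fixpoint all_up t : 'rV[F]_(d t) := if t is t'.+1 then row_mx (all_up t') 0 else 1%:M.

Lemma all_up_raise t : all_up t *m raise t = 0.
Proof.
elim: t => [|t IH] /=; first by rewrite mulmx0.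
by rewrite (mul_row_block (all_up t)) IH !mul0mx !mulmx0 !addr0 row_mx0.
Qed.

Lemma all_up_weight_op t : all_up t *m weight_op t = q ^+ t *: all_up t.
Proof.
elim: t => [|t IH] /=; first by rewrite mulmx1 scale1r.
rewrite (mul_row_block (all_up t)) !mul0mx !mulmx0 !addr0 -scalemxAr IH.
by rewrite scalerA -exprS (scale_row_mx (q ^+ _)) scaler0.
Qed.

(** * Tensors of diagrams, encoded by words *)

Implicit Types g h : nat -> bool.

(** The linear map of the monic diagram t -> n with word g; rows are indexed by
    labels of the bottom points, columns by labels of the top points.  A letter
    true joins the new point to the last through string by a cup, a letter false
    adds a through string; the map is zero if g does not leave t of them. *)
Fixpoint tensor_mx (g : nat -> bool) n : forall t, 'M[F]_(d t, d n) :=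
  if n is n'.+1 then
    if g n' then fun t =>
      let M : 'M_(d t + d t, d n') := tensor_mx g n' t.+1 in
      row_mx (a^-1 *: dsubmx M) (a *: usubmx M)
    else fun t => if t is t'.+1
      then block_mx (tensor_mx g n' t') 0 0 (tensor_mx g n' t') else 0
  else fun t => if t is 0 then 1%:M else 0.

Lemma tensor_open g n t : ~~ g n -> tensor_mx g n.+1 t.+1
   = block_mx (tensor_mx g n t) 0 0 (tensor_mx g n t).
Proof. by move=> /= /negPf ->. Qed.

Lemma tensor_open0 g n : ~~ g n -> tensor_mx g n.+1 0 = 0.
Proof. by move=> /= /negPf ->. Qed.

Lemma tensor_close g n t (U D : 'M_(d t, d n)) : g n ->
  tensor_mx g n t.+1 = col_mx U D ->
  tensor_mx g n.+1 t = row_mx (a^-1 *: D) (a *: U).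
Proof. by move=> /= -> ->; rewrite col_mxKu col_mxKd. Qed.

Lemma tensor_vsplit g n t :
  exists U D : 'M_(d t, d n), tensor_mx g n t.+1 = col_mx U D.
Proof.
pose M : 'M_(d t + d t, d n) := tensor_mx g n t.+1.
by exists (usubmx M), (dsubmx M); rewrite vsubmxK.
Qed.

Lemma tensor_ext g g' n t : (forall k, (k < n)%N -> g k = g' k) ->
  tensor_mx g n t = tensor_mx g' n t.
Proof.
elim: n t => [//|n IH] t eqg /=; rewrite eqg //.
have IH' s : tensor_mx g n s = tensor_mx g' n s.
  by apply: IH => k ltk; apply: eqg; rewrite ltnW.
by case: (g' n); [rewrite IH' | case: t => // t; rewrite IH'].
Qed.

(** A cup has weight zero. *)
Lemma tensor_weight_op g n t :
  weight_op t *m tensor_mx g n t = tensor_mx g n t *m weight_op n.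
Proof.
elim: n t => [|n IH] t; first by case: t => [|t] /=; rewrite ?mulmx0 ?mul0mx ?mulmx1.
have [cl|op] := boolP (g n); last first.
  case: t => [|t]; first by rewrite tensor_open0 // mulmx0 mul0mx.
  rewrite tensor_open //= !mulmx_block !mul0mx !mulmx0 !addr0 !add0r.
  by rewrite -!scalemxAl -!scalemxAr IH.
have [U [D e]] := tensor_vsplit g n t.
have := IH t.+1; rewrite e (tensor_close cl e) /= mul_block_col mul_col_mx.
rewrite !mul0mx addr0 add0r -!scalemxAl => /eq_col_mx[eU eD].
rewrite mul_row_block mul_mx_row !mulmx0 addr0 add0r -!scalemxAr -!scalemxAl.
rewrite -eU -eD !scalerA.
by congr row_mx; congr (_ *: _); field; rewrite ?a_neq0 ?q_neq0.
Qed.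

Let aq : a^-1 = - (a * q).
Proof. by apply: (mulfI a_neq0); rewrite divff // mulrN mulrA aaq opprK. Qed.

(** A cup is killed by E: the two contributions are a^-1 and a q times the same
    vector, and a^-1 = - a q. *)
Lemma tensor_raise g n t :
  raise t *m tensor_mx g n t = tensor_mx g n t *m raise n.
Proof.
elim: n t => [|n IH] t.
  by case: t => [|t] /=; rewrite ?mulmx0 ?mul0mx.
have [cl|op] := boolP (g n); last first.
  case: t => [|t]; first by rewrite tensor_open0 // mulmx0 mul0mx.
  rewrite tensor_open //= !mulmx_block !mul0mx !mulmx0 !addr0 !add0r.
  by rewrite IH tensor_weight_op.
have [U [D e]] := tensor_vsplit g n t.
have := IH t.+1; have := tensor_weight_op g n t.+1.
rewrite e (tensor_close cl e) /= !mul_block_col !mul_col_mx.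
rewrite !mul0mx !addr0 !add0r -!scalemxAl
  => /eq_col_mx[eU _] /eq_col_mx[eU' eD'].
rewrite mul_row_block mul_mx_row !mulmx0 add0r -!scalemxAr -!scalemxAl.
rewrite -eU -eU' -eD' scalerDr !scalerA addrAC -scalerDl.
by rewrite aq addNr scale0r add0r.
Qed.

Lemma tensor_lower g n t :
  lower t *m tensor_mx g n t = tensor_mx g n t *m lower n.
Proof.
elim: n t => [|n IH] t.
  by case: t => [|t] /=; rewrite ?mulmx0 ?mul0mx.
have [cl|op] := boolP (g n); last first.
  case: t => [|t]; first by rewrite tensor_open0 // mulmx0 mul0mx.
  rewrite tensor_open //= !mulmx_block !mul0mx !mulmx0 !addr0 !add0r.
  by rewrite IH tensor_weight_op.
have [U [D e]] := tensor_vsplit g n t.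
have := IH t.+1; have := tensor_weight_op g n t.+1.
rewrite e (tensor_close cl e) /= !mul_block_col !mul_col_mx.
rewrite !mul0mx !addr0 !add0r -!scalemxAl
  => /eq_col_mx[_ eD] /eq_col_mx[eU' eD'].
rewrite mul_row_block mul_mx_row !mulmx0 addr0 -!scalemxAr -!scalemxAl.
rewrite -eD -eU' -eD' scalerDr !scalerA addrCA -scalerDl.
by rewrite aq mulNr mulfK // addNr scale0r addr0.
Qed.

(** Monic diagrams compose to monic diagrams or to zero.  On words this is an
    induction on the last letter of the upper diagram: a closing letter is moved
    past the lower diagram by adding a vertical string to the latter. *)
Lemma tensor_comp g' s t g n :
  tensor_mx g' t s *m tensor_mx g n t = 0 \/
  exists g'', tensor_mx g' t s *m tensor_mx g n t = tensor_mx g'' n s.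
Proof.
(* The word h with its letter at m replaced by b. *)
pose ext h m b := fun k : nat => if k == m then b else h k.
have extE h m b r : tensor_mx (ext h m b) m r = tensor_mx h m r.
  by apply: tensor_ext => k; rewrite /ext ltn_neqAle => /andP[/negPf->].
have extm h m b : ext h m b m = b by rewrite /ext eqxx.
elim: n s t g' => [|n IH] s t g'.
  case: t => [|t]; last by left; rewrite mulmx0.
  by right; exists g'; rewrite [tensor_mx g 0 0]/= mulmx1.
have [cl|op] := boolP (g n).
  have [U [D e]] := tensor_vsplit g n t.
  have opt : ~~ ext g' t false t by rewrite extm.
  have := IH s.+1 t.+1 (ext g' t false).
  rewrite (tensor_close cl e) mul_mx_row -!scalemxAr tensor_open // extE e.
  rewrite mul_block_col !mul0mx addr0 add0r => -[/eqP|[h eh]].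
    by rewrite col_mx_eq0 => /andP[/eqP-> /eqP->]; left; rewrite !scaler0 row_mx0.
  right; exists (ext h n true); rewrite -(extE h n true) in eh.
  by rewrite (@tensor_close _ _ _ _ _ _ (esym eh)) ?extm.
case: t => [|t]; first by left; rewrite tensor_open0 // mulmx0.
rewrite tensor_open //.
have [cl'|op'] := boolP (g' t).
  have [U [D e]] := tensor_vsplit g' t s.
  have := IH s.+1 t g'.
  rewrite (tensor_close cl' e) mul_row_block !mulmx0 addr0 add0r -!scalemxAl.
  rewrite e mul_col_mx => -[/eqP|[h eh]].
    by rewrite col_mx_eq0 => /andP[/eqP-> /eqP->]; left; rewrite !scaler0 row_mx0.
  right; exists (ext h n true); rewrite -(extE h n true) in eh.
  by rewrite (@tensor_close _ _ _ _ _ _ (esym eh)) ?extm.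
case: s => [|s]; first by left; rewrite tensor_open0 // mul0mx.
rewrite tensor_open // mulmx_block !mul0mx !mulmx0 !addr0 add0r.
have [->|[h eh]] := IH s t g'; first by left; rewrite /block_mx !row_mx0 col_mx0.
right; exists (ext h n false).
by rewrite tensor_open ?extm // extE eh.
Qed.

(** * The span of the state vectors and its rank *)

Definition set_word n (w : {set 'I_n}) (k : nat) : bool := [exists i in w, i == k :> nat].

Lemma set_word_surj g n : exists w : {set 'I_n}, forall k, (k < n)%N -> set_word w k = g k.
Proof.
exists [set i : 'I_n | g i] => k ltk; apply/existsP/idP => [[j]|gk].
  by rewrite inE => /andP[gj /eqP<-].
by exists (Ordinal ltk); rewrite inE gk eqxx.
Qed.

(** The span H_t(n) of the state vectors of all words of length n; words that do
    not describe a diagram t -> n contribute the zero vector. *)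
Definition cell_span t n : 'M[F]_(d n) :=
  (\sum_(w : {set 'I_n}) <<all_up t *m tensor_mx (set_word w) n t>>)%MS.

Lemma mem_cell_span g t n : (all_up t *m tensor_mx g n t <= cell_span t n)%MS.
Proof.
have [w ew] := set_word_surj g n; rewrite -(tensor_ext _ ew).
by rewrite (sumsmx_sup w) // genmxE.
Qed.

Lemma cell_span_min t n m (A : 'M_(m, d n)) :
  (forall g, (all_up t *m tensor_mx g n t <= A)%MS) -> (cell_span t n <= A)%MS.
Proof. by move=> sA; apply/sumsmx_subP => w _; rewrite genmxE. Qed.

Lemma cell_span_mul_min t n m p (B : 'M_(d n, p)) (A : 'M_(m, p)) :
  (forall g, (all_up t *m tensor_mx g n t *m B <= A)%MS) ->
  (cell_span t n *m B <= A)%MS.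
Proof.
move=> sA; rewrite /cell_span sumsmxMr_gen; apply/sumsmx_subP => w _.
by rewrite genmxE (eqmxMr _ (genmxE _)).
Qed.

(** The quantum integer [t], normalised to be a polynomial in q^2. *)
Definition qnum t : F := (q ^+ t.*2 - 1) / (q ^+ 2 - 1).

Lemma qnumS t : qnum t.+1 = qnum t + q ^+ t.*2.
Proof.
have q2 : q ^+ 2 - 1 != 0 by rewrite subr_eq0.
by rewrite /qnum doubleS !exprS; field.
Qed.

Lemma cell_span_raise t n : cell_span t n *m raise n = 0.
Proof.
apply/sub_kermxP/cell_span_min => g; apply/sub_kermxP.
by rewrite -mulmxA -tensor_raise mulmxA all_up_raise mul0mx.
Qed.

Lemma cell_span_cartan t n : cell_span t n *m cartan n = qnum t *: cell_span t n.
Proof.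
have q2 : q ^+ 2 - 1 != 0 by rewrite subr_eq0.
apply/eqP; rewrite -mul_mx_scalar -subr_eq0 -mulmxBr; apply/eqP.
apply/sub_kermxP/cell_span_min => g; apply/sub_kermxP.
set u := all_up t *m _.
have uw : u *m weight_op n = q ^+ t *: u.
  by rewrite -mulmxA -tensor_weight_op mulmxA all_up_weight_op scalemxAl.
apply: (scalerI q2); rewrite scaler0 mulmxBr scalerBr mul_mx_scalar scalerA.
rewrite scalemxAr cartan_weight_op mulmxBr mulmx1 mulmxA uw -scalemxAl uw scalerA.
by rewrite /qnum [_ * (_ / _)]mulrC divfK // scalerBl scale1r -exprD addnn subrr.
Qed.

(** On vectors killed by E and of weight t, the commutation relation leaves only
    the diagonal term, whose value is [t]. *)
Lemma cell_span_lower_raise t n :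
  cell_span t n *m lower n *m raise n = qnum t *: cell_span t n.
Proof.
rewrite -mulmxA lower_raise mulmxDr -scalemxAr mulmxA cell_span_raise mul0mx.
by rewrite scaler0 add0r cell_span_cartan.
Qed.

Lemma cell_span_comp g s t n :
  (cell_span s t *m tensor_mx g n t <= cell_span s n)%MS.
Proof.
apply: cell_span_mul_min => h; rewrite -mulmxA.
have [->|[k ->]] := tensor_comp h s t g n; first by rewrite mulmx0 sub0mx.
exact: mem_cell_span.
Qed.

Lemma cell_span_open t n m (A : 'M_(m, d n)) : (A <= cell_span t n)%MS ->
  ((row_mx A 0 : 'M_(_, d n.+1)) <= cell_span t.+1 n.+1)%MS.
Proof.
move=> sA.
have -> : row_mx A 0 = A *m row_mx 1%:M (0 : 'M_(d n)).
  by rewrite mul_mx_row mulmx1 mulmx0.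
apply: submx_trans (submxMr _ sA) _.
apply: cell_span_mul_min => h.
pose g k := (k != n) && h k.
have op : ~~ g n by rewrite /g eqxx.
have := mem_cell_span g t.+1 n.+1; rewrite tensor_open //=.
rewrite mul_row_block !mul0mx !addr0 mul_mx_row mulmx1 !mulmx0.
rewrite (@tensor_ext g h) => [|k ltk]; first exact.
by rewrite /g neq_ltn ltk.
Qed.

Lemma tensor_id t : tensor_mx (fun=> false) t t = 1%:M.
Proof. by elim: t => //= t ->; rewrite -scalar_mx_block. Qed.

(** The vector up (x) ... (x) up (x) down; applying a diagram to it lowers the
    rightmost through string. *)
Definition last_down t : 'rV[F]_(d t) := if t is t'.+1 then row_mx 0 (all_up t') else 0.

Definition cell_span_pred t n : 'M[F]_(d n) :=
  if t is t'.+1 then cell_span t' n else 0.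

Lemma cell_span_open_pred t n m (A : 'M_(m, d n)) : (A <= cell_span_pred t n)%MS ->
  ((row_mx A 0 : 'M_(_, d n.+1)) <= cell_span t n.+1)%MS.
Proof.
case: t => [|t]; last exact: cell_span_open.
by rewrite submx0 => /eqP->; rewrite row_mx0 sub0mx.
Qed.

(** Bending the last bottom point of a diagram t+1 -> n up to a new last top
    point gives a diagram t -> n+1. *)
Lemma cell_span_cup g t n :
  ((row_mx (a^-1 *: (last_down t.+1 *m tensor_mx g n t.+1))
          (a *: (all_up t.+1 *m tensor_mx g n t.+1)) : 'rV_(d n.+1))
    <= cell_span t n.+1)%MS.
Proof.
have [w ew] : exists h, (h n = true) /\ (forall k, (k < n)%N -> h k = g k).
  exists (fun k => (k == n) || g k); split=> [|k ltk]; first by rewrite eqxx.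
  by rewrite (ltn_eqF ltk).
have [U [D e]] := tensor_vsplit g n t.
case: ew => wn /tensor_ext ew; rewrite -ew in e.
have := mem_cell_span w t n.+1; rewrite (tensor_close _ e) ?wn //.
rewrite -!ew e [last_down _]/= [all_up t.+1]/= !mul_row_col !mul0mx addr0 add0r.
by rewrite mul_mx_row -!scalemxAr.
Qed.

(** Rewrites a combination of the two components as a multiple of a bent string,
    using a^-1 = - a q. *)
Let cup_rowE c t n (U V : 'M[F]_(t, n)) :
  row_mx (c * q *: U) (- c *: V)
    = (- c / a) *: row_mx (a^-1 *: U) (a *: V).
Proof.
rewrite scale_row_mx !scalerA divfK //.
by rewrite {2}aq mulrN mulNr mulNr opprK mulrA divfK.
Qed.

(** Lowering one string or its right neighbour gives the same result up to a
    power of q and a cup joining the two strings.  So F (up (x) ... (x) up), the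
    sum over all strings, is a multiple of the vector with the last string
    lowered, modulo cups; the coefficients add up to [t] times a power of q. *)
Lemma all_up_lower t :
  (q ^+ t *: (all_up t *m lower t) - (q * qnum t) *: last_down t
     <= (if t is t'.+1 then cell_span_pred t' t else 0))%MS.
Proof.
elim: t => [|t IH]; first by rewrite /= mulmx0 !scaler0 subrr sub0mx.
rewrite [all_up t.+1]/= [lower _]/= [last_down t.+1]/=.
rewrite mul_row_block !mulmx0 !mul0mx !addr0 all_up_weight_op.
set c := q * qnum t in IH *.
set v := _ - _ in IH.
have -> : q ^+ t.+1 *: row_mx (all_up t *m lower t) (q ^+ t *: all_up t)
     - (q * qnum t.+1) *: row_mx 0 (all_up t)
   = q *: row_mx v 0 + row_mx (c * q *: last_down t) (- c *: all_up t).
  rewrite !(scale_row_mx q) !scale_row_mx !scaler0 opp_row_mx !add_row_mx.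
  rewrite oppr0 addr0 add0r; congr row_mx.
    by rewrite scalerBr !scalerA -exprS (mulrC q c) subrK.
  rewrite scalerA -scalerBl qnumS; congr (_ *: _).
  by rewrite /c -addnn exprD exprS; ring.
apply: addmx_sub.
  apply: scalemx_sub; clearbody v; clear c; case: t v IH => [|t] v.
    by rewrite submx0 => /eqP->; rewrite row_mx0 sub0mx.
  exact: cell_span_open_pred.
rewrite cup_rowE; clear v IH; rewrite /c; clear c.
case: t => [|t].
  by rewrite /qnum subrr mul0r mulr0 oppr0 mul0r scale0r sub0mx.
apply: scalemx_sub.
by have := cell_span_cup (fun=> false) t t.+1; rewrite tensor_id !mulmx1.
Qed.

(** The relation of [all_up_lower], transported along a diagram. *)
Lemma last_down_mem g t n : (0 < t)%N ->
  (q ^+ t *: (all_up t *m tensor_mx g n t *m lower n)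
     - (q * qnum t) *: (last_down t *m tensor_mx g n t)
     <= cell_span_pred t.-1 n)%MS.
Proof.
case: t => // t _; rewrite -mulmxA -tensor_lower mulmxA !scalemxAl -mulmxBl.
rewrite -[_ *: all_up _ *m lower _]scalemxAl.
have := submxMr (tensor_mx g n t.+1) (all_up_lower t.+1) => /submx_trans; apply.
case: t => [|t]; first by rewrite mul0mx sub0mx.
exact: cell_span_comp.
Qed.

(** Both inclusions compare two lifts of a state vector u of H_(s+1)(n) to
    H_s(n+1): the bent diagram, and u (x) down + gamma F u (x) up.  They differ by
    an element of H_(s-1)(n) (x) up, by [last_down_mem]. *)
Lemma cell_span_step s n (gamma := - (q ^+ s.+1 / qnum s.+1)) :
  qnum s.+1 != 0 ->
  (cell_span s n.+1 :=: block_mx (cell_span_pred s n) 0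
     (gamma *: (cell_span s.+1 n *m lower n)) (cell_span s.+1 n))%MS.
Proof.
move=> c0.
pose phi m (A : 'M_(m, d n)) : 'M_(m, d n.+1) :=
  row_mx (gamma *: (A *m lower n)) A.
have phiM m p (A : 'M_(m, d n)) (B : 'M_(p, m)) : phi p (B *m A) = B *m phi m A.
  by rewrite /phi mul_mx_row -scalemxAr mulmxA.
(* The difference of the two lifts of the state vector of g. *)
have diff g :
  (phi _ (all_up s.+1 *m tensor_mx g n s.+1) - a^-1 *:
    row_mx (a^-1 *: (last_down s.+1 *m tensor_mx g n s.+1))
           (a *: (all_up s.+1 *m tensor_mx g n s.+1))
    <= row_mx (cell_span_pred s n) 0)%MS.
  rewrite /phi scale_row_mx opp_row_mx add_row_mx !scalerA mulVf // scale1r subrr.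
  have := last_down_mem g n (ltn0Sn s); rewrite -[s.+1.-1]/s.
  set x := all_up _ *m _ *m _; set y := last_down _ *m _ => sxy.
  have -> : gamma *: x - (a^-1 * a^-1) *: y =
    (- (qnum s.+1)^-1) *: (q ^+ s.+1 *: x - (q * qnum s.+1) *: y).
    rewrite scalerBr !scalerA /gamma; congr (_ *: _ - _ *: _).
      by rewrite mulrC mulNr.
    rewrite {1}aq mulNr mulrAC divff // mul1r; field.
    by rewrite c0.
  have /submxP[B ->] := scalemx_sub (- (qnum s.+1)^-1) sxy.
  by rewrite -[0 in X in (X <= _)%MS](mulmx0 _ B) -mul_mx_row submxMl.
apply/eqmxP/andP; split.
  apply: cell_span_min => g.
  have [cl|op] := boolP (g n); last first.
    case: s => [|s] in gamma c0 phi phiM diff *.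
      by rewrite tensor_open0 // mulmx0 sub0mx.
    rewrite tensor_open // mul_row_block !mulmx0 mul0mx !addr0.
    have /submxP[B ->] := mem_cell_span g s n.
    rewrite -[0 in X in (X <= _)%MS](mulmx0 _ B) -mul_mx_row.
    by apply: submx_trans (submxMl _ _) _; rewrite /block_mx -addsmxE addsmxSl.
  have [U [D e]] := tensor_vsplit g n s.
  rewrite (tensor_close cl e).
  have := diff g; rewrite e [last_down _]/= [all_up s.+1]/= !mul_row_col !mul0mx addr0 add0r.
  set L := phi _ _; set M := row_mx _ _ => sLM.
  have -> : all_up s *m row_mx (a^-1 *: D) (a *: U) = M.
    by rewrite mul_mx_row -!scalemxAr.
  have -> : M = a *: (L - (L - a^-1 *: M)) by rewrite opprB addrC subrK scalerA divff ?scale1r.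
  apply/scalemx_sub/addmx_sub; last first.
    rewrite -scaleN1r; apply: scalemx_sub; apply: submx_trans sLM _.
    by rewrite /block_mx -addsmxE addsmxSl.
  rewrite /block_mx -addsmxE; apply: submx_trans (addsmxSr _ _).
  have : (all_up s *m U <= cell_span s.+1 n)%MS.
    by have := mem_cell_span g s.+1 n; rewrite e mul_row_col mul0mx addr0.
  by case/submxP=> B eB; rewrite /L eB phiM submxMl.
rewrite /block_mx -addsmxE addsmx_sub cell_span_open_pred ?submx_refl //=.
rewrite -/(phi _ (cell_span s.+1 n)).
have -> : phi _ (cell_span s.+1 n) = cell_span s.+1 n *m phi _ 1%:M by rewrite -phiM mulmx1.
apply: cell_span_mul_min => g; rewrite -phiM mulmx1.
have := diff g; set L := phi _ _; set M := row_mx _ _ => sLM.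
rewrite -[L](subrK (a^-1 *: M)); apply: addmx_sub.
  apply: submx_trans sLM _; exact: cell_span_open_pred.
by apply: scalemx_sub; apply: cell_span_cup.
Qed.

Definition gram_rank t n := \rank (cell_span t n *m (cell_span t n)^T).

(** This makes the rank of the dot product depend only on the row space. *)
Lemma rank_gram_le m p r (A : 'M[F]_(m, r)) (B : 'M_(p, r)) :
  (A <= B)%MS -> (\rank (A *m A^T) <= \rank (B *m B^T))%N.
Proof.
case/submxP=> C ->; rewrite trmx_mul mulmxA -(mulmxA C).
apply: leq_trans (mxrankM_maxl _ _) _; exact: mxrankM_maxr.
Qed.

Lemma rank_gram_eqmx m p r (A : 'M[F]_(m, r)) (B : 'M_(p, r)) :
  (A :=: B)%MS -> \rank (A *m A^T) = \rank (B *m B^T).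
Proof.
by move=> AB; apply/eqP; rewrite eqn_leq !rank_gram_le // AB.
Qed.

(** In the decomposition of [cell_span_step] the Gram matrix is block diagonal,
    and its second block is gamma^2 [s+1] + 1 = [s+2] / [s+1] times the Gram
    matrix of H_(s+1)(n). *)
Lemma gram_rank_rec s n : qnum s.+1 != 0 ->
  gram_rank s n.+1 = ((if s is s'.+1 then gram_rank s' n else 0)
                      + (qnum s.+2 != 0%R) * gram_rank s.+1 n)%N.
Proof.
move=> c0; rewrite /gram_rank (rank_gram_eqmx (cell_span_step n c0)).
set X := cell_span_pred s n; set Y := cell_span s.+1 n.
set gamma := - _.
have XF : X *m (lower n)^T = 0.
  rewrite -raise_tr trmxK /X; case: (s) => [|s'] /=; first by rewrite mul0mx.
  exact: cell_span_raise.
rewrite (tr_block_mx X) mulmx_block !trmx0 !mulmx0 !mul0mx !addr0.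
have -> : X *m (gamma *: (Y *m lower n))^T = 0.
  by rewrite linearZ /= trmx_mul -scalemxAr mulmxA XF mul0mx scaler0.
have -> : (gamma *: (Y *m lower n)) *m X^T = 0.
  rewrite -scalemxAl -mulmxA.
  by rewrite -(trmxK (lower n *m _)) trmx_mul trmxK XF trmx0 mulmx0 scaler0.
rewrite rank_diag_block_mx; congr (_ + _)%N.
  by rewrite /X; case: (s) => //=; rewrite mul0mx mxrank0.
rewrite linearZ /= trmx_mul lower_tr -!scalemxAl -scalemxAr scalerA mulmxA.
rewrite cell_span_lower_raise -scalemxAl scalerA -[X in _ + X]scale1r -scalerDl.
have -> : gamma * gamma * qnum s.+1 + 1 = qnum s.+2 / qnum s.+1.
  rewrite (qnumS s.+1) /gamma mulrDl divff // addrC; congr (_ + _).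
  rewrite mulrNN -mulrA divfK // -addnn exprD; field.
  by rewrite c0.
have [->|c1] := eqVneq (qnum s.+2) 0; first by rewrite mul0r scale0r mxrank0.
by rewrite mul1n mxrank_scale_nz // mulf_neq0 ?invr_eq0.
Qed.

Lemma gram_rank0 t : gram_rank t 0 = (t == 0%N).
Proof.
rewrite /gram_rank.
case: t => [|t].
  have e : (cell_span 0 0 :=: (1%:M : 'M[F]_1))%MS.
    apply/eqmxP; rewrite submx1 /=.
    by have := mem_cell_span xpred0 0 0; rewrite /= mulmx1.
  by rewrite (rank_gram_eqmx e) mul1mx trmx1 mxrank1.
suff -> : cell_span t.+1 0 = 0 by rewrite mul0mx mxrank0.
by apply/eqP; rewrite -submx0; apply: cell_span_min => g; rewrite mulmx0 sub0mx.
Qed.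
End TensorModel.

(** * Planar link states and their weights *)

(** For m different from k and l: m lies strictly between k and l.  In this form
    the relation is additive along chains of points ([separates_trans]), and
    planarity of arcs becomes an equality of booleans. *)
Definition separates (k l m : nat) : bool := (k < m)%N (+) (l < m)%N.

Lemma separates_refl (k m : nat) : separates k k m = false.
Proof. exact: addbb. Qed.

Lemma separatesC (k l m : nat) : separates k l m = separates l k m.
Proof. exact: addbC. Qed.

Lemma separates_trans (x y k l m : nat) :
  separates k l m = separates k x m (+) separates x y m (+) separates y l m.
Proof. by rewrite /separates; do 4!case: (_ < m)%N. Qed.

(** The position of p relative to the far end z of an arc at y, respectively at x,
    when x and y are adjacent and the arc does not pass over p. *)
Lemma past_gap (x y z p : nat) : ~~ (x < p < y)%N -> p != y ->
  ~~ separates y z p -> (x < p)%N -> (z < p)%N.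
Proof. by rewrite /separates; lia. Qed.

Lemma before_gap (x y z p : nat) : ~~ (x < p < y)%N -> p != x -> p != z ->
  ~~ separates x z p -> (p < y)%N -> (p < z)%N.
Proof. by rewrite /separates; lia. Qed.

Section Contraction.
Variables (F : fieldType) (a : F) (n : nat).
Hypothesis a_neq0 : a != 0.
Local Notation T := 'I_n.
Implicit Types (S s : {set T}) (al be : T -> T) (x y z k : T).

(** The coefficient of a cup at labels l and r of its left and right end points,
    where true stands for down. *)
Definition cup_weight (l r : bool) : F :=
  if l == r then 0 else if r then a else a^-1.

(** The weight of a cup is attributed to its right end point, where the cup is
    completed when points are read from left to right.  Fixed points of [al] are
    tops of through strings, which are labelled up. *)
Definition site_weight al s k : F :=
  if al k == k then (k \notin s)%:R
  else if (al k < k)%N then cup_weight (al k \in s) (k \in s) else 1.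

Definition state_weight S al s : F := \prod_(k in S) site_weight al s k.

Definition loop_weight : F := a ^+ 2 + a^-1 ^+ 2.

(** The upper half of a monic diagram, restricted to a set S of points: an
    involution whose two-point orbits are the cups and whose fixed points are the
    tops of the through strings.  Cups do not cross, and no through string starts
    below a cup. *)
Record link_state S al : Prop := LinkState {
  link_in : {in S, forall k, al k \in S};
  linkK : {in S, forall k, al (al k) = k};
  link_noncross : {in S &, forall k u, u != k -> u != al k ->
    separates k (al k) (al u) = separates k (al k) u};
  link_exposed : {in S &, forall k u, al u = u -> u != k ->
    ~~ separates k (al k) u} }.

(** The fixed points of [al], numbered from left to right by the through strings. *)
Record enum_defects S al t (p : 'I_t -> T) : Prop := EnumDefects {
  defect_in : forall i, p i \in S;
  defect_fix : forall i, al (p i) = p i;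
  defect_onto : {in S, forall k, al k = k -> exists i, k = p i};
  defect_mono : forall i j : 'I_t, (i < j)%N -> (p i < p j)%N }.

(** The map c takes equal values exactly on the points that are connected by arcs
    of [al] and [be].  Connectedness is expressed by invariant boolean functions
    instead of paths, since such functions are easily extended along a
    contraction. *)
Record component_map (C : finType) S al be (c : T -> C) : Prop := ComponentMap {
  comp_al : {in S, forall k, c (al k) = c k};
  comp_be : {in S, forall k, c (be k) = c k};
  comp_sep : forall f : T -> bool,
    {in S, forall k, f (al k) = f k} -> {in S, forall k, f (be k) = f k} ->
    {in S &, forall k l, c k = c l -> f k = f l} }.

(** * Contraction along an adjacent pair of points *)

Lemma link_state_ext S al be :
  {in S, al =1 be} -> link_state S al -> link_state S be.
Proof.
move=> e [al_in alK alN alE]; split.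
- by move=> k kS; rewrite -e // al_in.
- by move=> k kS; rewrite -!e ?al_in ?alK.
- by move=> k u kS uS; rewrite -!e //; apply: alN.
- by move=> k u kS uS; rewrite -!e //; apply: alE.
Qed.

(** The link state left on the other points when an arc from x to y is glued to
    [al] from the other side: the partners of x and y are joined; if one of x and
    y is a fixed point, the partner of the other one becomes fixed. *)
Definition contract al x y k : T :=
  if al k == x then (if al y == y then k else al y)
  else if al k == y then (if al x == x then k else al x) else al k.

Variant contract_spec al x y k k' : Prop :=
| ContractKeep of k' = al k & al k != x & al k != y
| ContractLeftDefect of k' = k & al k = x & al x = k & al y = y
| ContractLeft of k' = al y & al k = x & al x = k & al y != y & al y != k
| ContractRightDefect of k' = k & al k = y & al y = k & al x = x
| ContractRight of k' = al x & al k = y & al y = k & al x != x & al x != k.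

Section Contract.
Variables (S : {set T}) (x y : T).
Hypotheses (xS : x \in S) (yS : y \in S) (xy : (x < y)%N).
Hypothesis adj : {in S, forall k : T, ~~ (x < k < y)%N}.
Let S' := S :\ x :\ y.

Let inS' k : (k \in S') = [&& k != y, k != x & k \in S].
Proof. by rewrite !inE. Qed.

Let xNy : x != y. Proof. by rewrite neq_ltn xy. Qed.

Lemma contractP al k : link_state S al -> k \in S' ->
  let k' := contract al x y k in
  k' \in S' /\ contract_spec al x y k k'.
Proof.
move=> L; rewrite inS' => /and3P[ky kx kS] /=; rewrite /contract.
have kk := linkK L kS; have xx := linkK L xS; have yy := linkK L yS.
have akS := link_in L kS; have axS := link_in L xS; have ayS := link_in L yS.
have [ex|nx] := eqVneq (al k) x.
  have axk : al x = k by rewrite -ex.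
  have [ey|ny] := eqVneq (al y) y.
    by split; [rewrite inS' ky kx | constructor 2].
  have ayx : al y != x by apply: contra_neq ky => e; rewrite -axk -e yy.
  have ayk : al y != k by apply: contra_neq xNy => e; rewrite -ex -e yy.
  have ay' : al y \in S' by rewrite inS' ny ayx.
  by split => //; constructor 3.
have [ey|ny] := eqVneq (al k) y.
  have ayk : al y = k by rewrite -ey.
  have [ex|nx'] := eqVneq (al x) x.
    by split; [rewrite inS' ky kx | constructor 4].
  have axy : al x != y by apply: contra_neq kx => e; rewrite -ayk -e xx.
  have axk : al x != k by apply: contra_neq xNy => e; rewrite -ey -e xx.
  have ax' : al x \in S' by rewrite inS' nx' axy.
  by split => //; constructor 5.
by split; [rewrite inS' nx ny | constructor 1].
Qed.

(** The arc joining the partners of x and y separates points exactly when the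
    arcs at x and at y together do, because no point lies between x and y. *)
Lemma contract_link al : link_state S al -> link_state S' (contract al x y).
Proof.
move=> L.
have sub k : k \in S' -> k \in S by rewrite inS' => /and3P[].
have sepxy k : k \in S' -> ~~ separates x y k.
  rewrite inS' => /and3P[ky kx kS]; have := adj kS.
  by move: ky kx; rewrite -!val_eqE /separates /=; lia.
have sepxy' k k' : k \in S' -> k' \in S' -> separates k k' x = separates k k' y.
  rewrite !inS' => /and3P[ky kx kS] /and3P[ky' kx' kS']; have := adj kS'.
  have := adj kS; move: ky kx ky' kx'.
  by rewrite -!val_eqE /separates /=; lia.
split.
- by move=> k kS; case: (contractP L kS).
- move=> k kS; have := contractP L kS => -[_].
  case=> [-> nx ny|-> ex ax ay|-> ex ax ay ayk|-> ey ay ax|-> ey ay ax axk].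
  + rewrite /contract (linkK L (sub _ kS)).
    move: kS; rewrite inS' => /and3P[/negPf-> /negPf-> _] //.
  + by rewrite /contract ex eqxx ay eqxx.
  + rewrite /contract (linkK L yS) eq_sym (negPf xNy) eqxx ax.
    by move: kS; rewrite inS' => /and3P[_ /negPf-> _].
  + by rewrite /contract ey eq_sym (negPf xNy) eqxx ax eqxx.
  + rewrite /contract (linkK L xS) eqxx ay.
    by move: kS; rewrite inS' => /and3P[/negPf-> _ _].
- move=> k u kS uS uk.
  have [akS Ck] := contractP L kS; have [auS Cu] := contractP L uS.
  move: (kS) (uS); rewrite !inS' => /and3P[ky kx kS0] /and3P[uy ux uS0].
  have yk : y != k by rewrite eq_sym. have xk : x != k by rewrite eq_sym.
  move: (contract _ _ _ k) (contract _ _ _ u) akS auS Ck Cu => k' u' k'S u'S Ck Cu.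
  case: Ck => [ek kx' ky'|->|ek kx' xk' yy' yk'|->|ek ky' yk' xx' xk'];
    rewrite ?separates_refl // => uk'.
  + rewrite ek in uk' k'S *.
    have Nx := link_noncross L kS0 xS xk; have Ny := link_noncross L kS0 yS yk.
    have Nu := link_noncross L kS0 uS0 uk uk'.
    have exy := sepxy' _ _ kS k'S.
    rewrite eq_sym in kx'; rewrite eq_sym in ky'.
    move: Nx Ny => /(_ kx') Nx /(_ ky') Ny.
    case: Cu => [->|->|-> ux' _ _ _|->|-> uy' _ _ _] //.
      by rewrite Ny -exy -ux' Nu.
    by rewrite Nx exy -uy' Nu.
  + have eu : u' = al u.
      case: Cu => [//|_ _ xu|_ _ xu|_ _ yu|_ _ yu].
      * by rewrite -xu xk' eqxx in uk.
      * by rewrite -xu xk' eqxx in uk.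
      * by rewrite ek yu eqxx in uk'.
      * by rewrite ek yu eqxx in uk'.
    rewrite [LHS](separates_trans x y) [RHS](separates_trans x y) !(negPf (sepxy _ _)) // ek eu -kx'.
    rewrite (link_noncross L) ?kx' // (link_noncross L) //.
    by rewrite -ek.
  + have eu : u' = al u.
      case: Cu => [//|_ _ xu|_ _ xu|_ _ yu|_ _ yu].
      * by rewrite ek xu eqxx in uk'.
      * by rewrite ek xu eqxx in uk'.
      * by rewrite -yu yk' eqxx in uk.
      * by rewrite -yu yk' eqxx in uk.
    rewrite [LHS](separates_trans y x) [RHS](separates_trans y x).
    rewrite ![separates y x _]separatesC.
    rewrite !(negPf (sepxy _ _)) // ek eu -ky'.
    rewrite (link_noncross L) ?ky' // (link_noncross L) //.
    by rewrite -ek.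
- move=> k u kS uS.
  have [akS Ck] := contractP L kS; have [auS Cu] := contractP L uS.
  move: (kS) (uS); rewrite !inS' => /and3P[ky kx kS0] /and3P[uy ux uS0].
  have yk : y != k by rewrite eq_sym. have xk : x != k by rewrite eq_sym.
  move: (contract _ _ _ k) (contract _ _ _ u) akS auS Ck Cu => k' u' k'S u'S Ck Cu.
  move=> eu uk.
  case: Ck => [ek kx' ky'|->|ek kx' xk' yy' yk'|->|ek ky' yk' xx' xk'];
    rewrite ?separates_refl //.
  + rewrite ek in k'S *; have exy := sepxy' _ _ kS k'S.
    have E := link_exposed L kS0; have N := link_noncross L kS0 uS0 uk.
    case: Cu => [au _ _|_ ux' xu yy|e _ _ _ yu|_ uy' yu xx|e _ _ _ xu].
    * by apply: E => //; rewrite -au.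
    * rewrite -N; first by rewrite ux' exy; apply: E.
      by apply: contra_neq kx => e; rewrite -ux' e (linkK L).
    * by rewrite -e eu eqxx in yu.
    * rewrite -N; first by rewrite uy' -exy; apply: E.
      by apply: contra_neq ky => e; rewrite -uy' e (linkK L).
    * by rewrite -e eu eqxx in xu.
  + have au : al u = u.
      case: Cu => [<- //|_ _ xu|_ _ xu|_ _ _ xx|e _ _ _ xu].
      * by rewrite -xu xk' eqxx in uk.
      * by rewrite -xu xk' eqxx in uk.
      * by rewrite -xk' xx eqxx in kx.
      * by rewrite -e eu eqxx in xu.
    rewrite (separates_trans x y) (negPf (sepxy _ _)) // ek addbF -kx'.
    by rewrite (negPf (link_exposed L _ _ _ _)) // (link_exposed L).
  + have au : al u = u.
      case: Cu => [<- //|_ _ xu yy|e _ _ _ yu|_ _ yu|_ _ yu].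
      * by rewrite -yk' yy eqxx in ky.
      * by rewrite -e eu eqxx in yu.
      * by rewrite -yu yk' eqxx in uk.
      * by rewrite -yu yk' eqxx in uk.
    rewrite (separates_trans y x) separatesC [separates y x u]separatesC.
    rewrite (negPf (sepxy _ _)) // ek addbF -ky' separatesC.
    by rewrite (negPf (link_exposed L _ _ _ _)) // (link_exposed L).
Qed.

Lemma contract_cup be : link_state S be -> be x = y ->
  {in S', contract be x y =1 be}.
Proof.
move=> L bx k kS; have [_] := contractP L kS.
move: kS; rewrite inS' => /and3P[ky kx _].
case=> [//|_ _ xk|_ _ xk|_ _ yk|_ _ yk].
- by rewrite -xk bx eqxx in ky.
- by rewrite -xk bx eqxx in ky.
- by rewrite -yk -bx (linkK L) ?eqxx in kx.
- by rewrite -yk -bx (linkK L) ?eqxx in kx.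
Qed.

Lemma site_weight_eq al be s s' k : al k = be k ->
  (k \in s) = (k \in s') -> (be k \in s) = (be k \in s') ->
  site_weight al s k = site_weight be s' k.
Proof. by move=> e ks bs; rewrite /site_weight e ks bs. Qed.

Lemma site_weight_defect al s k : al k = k -> site_weight al s k = (k \notin s)%:R.
Proof. by rewrite /site_weight => ->; rewrite eqxx. Qed.

Lemma site_weight_opener al s k : (k < al k)%N -> site_weight al s k = 1.
Proof.
by move=> lk; rewrite /site_weight -val_eqE /= gtn_eqF // ltnNge ltnW.
Qed.

Lemma site_weight_closer al s k l : al k = l -> (l < k)%N ->
  site_weight al s k = cup_weight (l \in s) (k \in s).
Proof. by move=> <- lk; rewrite /site_weight lk -val_eqE /= ltn_eqF. Qed.

Lemma state_weight_split al s :
  state_weight S al s =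
  site_weight al s x * site_weight al s y * \prod_(k in S') site_weight al s k.
Proof.
rewrite /state_weight (big_setD1 x) //= (big_setD1 y) /=; first by rewrite mulrA.
by rewrite !inE eq_sym xNy.
Qed.

Let in_x1 s k : k \in S' -> (k \in x |: s) = (k \in s).
Proof. by rewrite inS' !inE => /and3P[_ /negPf->]. Qed.

Let in_y1 s k : k \in S' -> (k \in y |: s) = (k \in s).
Proof. by rewrite inS' !inE => /and3P[/negPf->]. Qed.

Let x_notin s : s \subset S' -> x \notin s.
Proof. by move=> /subsetP sS; apply/negP => /sS; rewrite inS' eqxx andbF. Qed.

Let y_notin s : s \subset S' -> y \notin s.
Proof. by move=> /subsetP sS; apply/negP => /sS; rewrite inS' eqxx. Qed.

Let ltyx : (y < x)%N = false. Proof. by rewrite ltnNge ltnW. Qed.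

Lemma state_weight_cup be s b : link_state S be -> be x = y -> s \subset S' ->
  state_weight S be ((if b then x else y) |: s)
   = (if b then a^-1 else a) * state_weight S' be s.
Proof.
move=> L bx sS; rewrite state_weight_split.
have by_ : be y = x by rewrite -bx (linkK L).
congr (_ * _); last first.
  apply: eq_bigr => k kS; have [+ _] := contractP L kS.
  rewrite (contract_cup L) // => bk.
  by apply: site_weight_eq; case: (b); rewrite ?in_x1 ?in_y1.
rewrite /site_weight bx by_ eq_sym (negPf xNy) ltyx xy mul1r.
case: b; rewrite !inE !eqxx ?(negPf (x_notin _)) ?(negPf (y_notin _)) //.
  by rewrite eq_sym (negPf xNy) orbF.
by rewrite (negPf xNy) orbF.
Qed.

(** Straightening a zigzag costs a a^-1 = 1, closing a loop gives a^2 + a^-2, and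
    a cup against two through strings gives zero, since it would need opposite
    labels while both are up. *)
Lemma state_weight_contract al s : link_state S al -> s \subset S' ->
  a^-1 * state_weight S al (x |: s) + a * state_weight S al (y |: s)
   = (if al x == y then loop_weight else if (al x == x) && (al y == y) then 0 else 1) *
     state_weight S' (contract al x y) s.
Proof.
move=> L sS; have [xx yy] := (linkK L xS, linkK L yS).
have [axy|axy] := eqVneq (al x) y.
  rewrite (state_weight_cup true L axy sS) (state_weight_cup false L axy sS).
  have -> : state_weight S' (contract al x y) s = state_weight S' al s.
    by apply: eq_bigr => k kS; apply: site_weight_eq; rewrite ?(contract_cup L).
  by rewrite /loop_weight !mulrA -mulrDl addrC !expr2.
have ayx : al y != x by apply: contra_neq axy => <-.
have [ltzx ltzy] : (forall z, z \in S' -> (z < y)%N = (z < x)%N) /\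
                   (forall z, z \in S' -> (y < z)%N = (x < z)%N).
  split=> z; rewrite inS' -!val_eqE /= => /and3P[zy zx /adj]; lia.
have xs := negPf (x_notin sS); have ys := negPf (y_notin sS).
have inx k : (k \in x |: s) = (k == x) || (k \in s) by rewrite !inE.
have iny k : (k \in y |: s) = (k == y) || (k \in s) by rewrite !inE.
have rest (A : {set T}) w : A \subset S' -> (forall k, k \in A -> al k != x /\ al k != y) ->
    w \in [:: x; y] ->
    \prod_(k in A) site_weight al (w |: s) k
      = \prod_(k in A) site_weight (contract al x y) s k.
  rewrite !inE => /subsetP AS nA wxy; apply: eq_bigr => k kA.
  have kS := AS k kA; have [akS Ck] := contractP L kS.
  have [nx ny] := nA k kA.
  have e : contract al x y k = al k.
    by case: Ck nx ny => // _ ->; rewrite eqxx.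
  rewrite e in akS; apply: site_weight_eq; rewrite ?e //.
    by case/orP: wxy => /eqP->; rewrite ?in_x1 ?in_y1.
  by case/orP: wxy => /eqP->; rewrite ?in_x1 ?in_y1.
rewrite !state_weight_split.
have [ax|ax] := eqVneq (al x) x; have [ay|ay] := eqVneq (al y) y => /=.
- by rewrite !site_weight_defect // !inE !eqxx !(mul0r, mulr0) addr0.
- set z := al y in ay *.
  have azy : al z = y := yy.
  have zS : z \in S' by rewrite inS' ay ayx (link_in L).
  have [nzx /= nzy] : z != x /\ z != y by split.
  have ltz : (y < z)%N.
    have := link_exposed L yS xS ax xNy.
    rewrite /separates ltyx /= -/z -leqNgt leq_eqVlt eq_sym val_eqE (negPf nzx) /=.
    by rewrite ltzy.
  have cz : contract al x y z = z by rewrite /contract azy eqxx ax eqxx eq_sym (negPf xNy).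
  have r w : w \in [:: x; y] -> \prod_(k in S') site_weight al (w |: s) k
     = site_weight al (w |: s) z *
       \prod_(k in S' :\ z) site_weight (contract al x y) s k.
    move=> wxy; rewrite (big_setD1 z) //= rest ?subsetDl // => k.
    rewrite in_setD1 inS' => /and4P[kz ky kx kS]; split.
      by apply: contra_neq kx => e; rewrite -(linkK L kS) e.
    by apply: contra_neq kz => e; rewrite -(linkK L kS) e.
  rewrite !r ?inE ?eqxx ?orbT // /state_weight (big_setD1 z zS) /=.
  rewrite !(site_weight_defect _ ax) (site_weight_defect _ cz).
  rewrite inx eqxx !mul0r mulr0 add0r iny (negPf xNy) xs /= !mul1r.
  rewrite (site_weight_opener (al := al) _ ltz) (site_weight_closer _ azy ltz) mul1r mulrA.
  congr (_ * _); rewrite !iny eqxx (negPf nzy) /cup_weight /=.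
  by case: (z \in s); rewrite /= ?mulr0 ?divff.
- set z := al x in ax axy *.
  have azx : al z = x := xx.
  have zS : z \in S' by rewrite inS' axy ax (link_in L).
  have ltz : (z < x)%N.
    have yNx : y != x by rewrite eq_sym.
    have := link_exposed L xS yS ay yNx.
    by rewrite /separates xy /= -/z ltzx // negbK.
  have cz : contract al x y z = z by rewrite /contract azx eqxx ay eqxx.
  have r w : w \in [:: x; y] -> \prod_(k in S') site_weight al (w |: s) k
     = site_weight al (w |: s) z *
       \prod_(k in S' :\ z) site_weight (contract al x y) s k.
    move=> wxy; rewrite (big_setD1 z) //= rest ?subsetDl // => k.
    rewrite in_setD1 inS' => /and4P[kz ky kx kS]; split.
      by apply: contra_neq kz => e; rewrite -(linkK L kS) e.
    by apply: contra_neq ky => e; rewrite -(linkK L kS) e.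
  rewrite !r ?inE ?eqxx ?orbT // /state_weight (big_setD1 z zS) /=.
  rewrite !(site_weight_defect _ ay) (site_weight_defect _ cz).
  rewrite iny eqxx !mulr0 mul0r mulr0 addr0 inx eq_sym (negPf xNy) ys /= mulr1 mul1r.
  rewrite (site_weight_closer (al := al) (k := x) _ (erefl z) ltz).
  have lta : (z < al z)%N by rewrite azx.
  rewrite (site_weight_opener _ lta) mul1r mulrA.
  congr (_ * _); rewrite !inx eqxx (negPf ax) /cup_weight /=.
  by case: (z \in s); rewrite /= ?mulr0 ?mulVf.
set z := al x in ax axy *; set z' := al y in ay ayx *.
have azx : al z = x := xx. have azy : al z' = y := yy.
have zS : z \in S' by rewrite inS' axy ax (link_in L).
have zS' : z' \in S' by rewrite inS' ay ayx (link_in L).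
have zz' : z != z' by apply: contra_neq xNy => e; rewrite -azx -azy e.
have z'z : z' != z by rewrite eq_sym.
have cz : contract al x y z = z' by rewrite /contract azx eqxx (negPf ay).
have cz' : contract al x y z' = z.
  by rewrite /contract azy eq_sym (negPf xNy) eqxx (negPf ax).
have r w : w \in [:: x; y] -> \prod_(k in S') site_weight al (w |: s) k
   = site_weight al (w |: s) z * (site_weight al (w |: s) z' *
     \prod_(k in S' :\ z :\ z') site_weight (contract al x y) s k).
  move=> wxy; rewrite (big_setD1 z) //= (big_setD1 z') /=; last first.
    by rewrite in_setD1 z'z zS'.
  rewrite rest // => [|k]; first exact: subset_trans (subsetDl _ _) (subsetDl _ _).
  rewrite in_setD1 in_setD1 inS' => /and5P[kz' kz ky kx kS]; split.
    by apply: contra_neq kz => e; rewrite -(linkK L kS) e.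
  by apply: contra_neq kz' => e; rewrite -(linkK L kS) e.
rewrite !r ?inE ?eqxx ?orbT // /state_weight (big_setD1 z zS) /=.
rewrite [in RHS](big_setD1 z') /=; last by rewrite in_setD1 z'z zS'.
rewrite mul1r; set P := \prod_(k in _) _.
have sep := link_noncross L xS yS.
have yNx : y != x by rewrite eq_sym.
have yNz : y != al x by rewrite eq_sym.
have {sep} := sep yNx yNz; rewrite -/z -/z' /separates xy addTb => sep.
move: (ltzx z zS) (ltzx z' zS') (ltzy z zS) (ltzy z' zS') => e1 e2 e3 e4.
have opener u v w : al u = v -> (u < v)%N -> site_weight al w u = 1.
  by move=> <-; apply: site_weight_opener.
have closer u v w : al u = v -> (v < u)%N ->
    site_weight al w u = cup_weight (v \in w) (u \in w).
  exact: site_weight_closer.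
have opener' u v w : contract al x y u = v -> (u < v)%N ->
    site_weight (contract al x y) w u = 1.
  by move=> <-; apply: site_weight_opener.
have closer' u v w : contract al x y u = v -> (v < u)%N ->
    site_weight (contract al x y) w u = cup_weight (v \in w) (u \in w).
  exact: site_weight_closer.
have yx : (y == x) = false by rewrite eq_sym (negPf xNy).
have zx_or : (z < x)%N \/ (x < z)%N by apply/orP; rewrite -neq_ltn.
have z'x_or : (z' < x)%N \/ (x < z')%N by apply/orP; rewrite -neq_ltn.
have ltz'z : (z' < z)%N = ~~ (z < z')%N.
  by rewrite ltn_neqAle val_eqE z'z leqNgt.
rewrite e1 in sep; case: zx_or => lz; case: z'x_or => lz'.
- have lz'z : (z' < z)%N.
    by rewrite ltz'z; move: sep; rewrite lz ltnNge (ltnW lz') /= => ->.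
  have [lzy lz'y] : (z < y)%N /\ (z' < y)%N by rewrite e1 e2.
  rewrite !(closer x z) // !(closer y z') // !(opener z x) // !(opener z' y) //.
  rewrite (closer' z z') // (opener' z' z) // !inx !iny !eqxx !(negPf xNy) yx.
  rewrite (negPf ax) (negPf axy) (negPf ay) (negPf ayx) xs ys /cup_weight /=.
  by case: (z \in s); case: (z' \in s); rewrite /=; field.
- have lzz' : (z < z')%N by exact: ltn_trans lz lz'.
  have lyz' : (y < z')%N by rewrite e4.
  rewrite !(closer x z) // !(opener y z') // !(opener z x) // !(closer z' y) //.
  rewrite (opener' z z') // (closer' z' z) // !inx !iny !eqxx !(negPf xNy) yx.
  rewrite (negPf ax) (negPf axy) (negPf ay) (negPf ayx) xs ys /cup_weight /=.
  by case: (z \in s); case: (z' \in s); rewrite /=; field.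
- move: sep; rewrite ltnNge (ltnW lz') [(z < x)%N]ltnNge (ltnW lz) /= => h.
  by have := ltn_trans (ltn_trans h lz') lz; rewrite ltnn.
- have lyz : (y < z)%N by rewrite e3.
  have lyz' : (y < z')%N by rewrite e4.
  have lz'z : (z' < z)%N.
    rewrite ltz'z; move: sep; rewrite lz' [(z < x)%N]ltnNge (ltnW lz) /=.
    by case: (z < z')%N.
  rewrite !(opener x z) // !(opener y z') // !(closer z x) // !(closer z' y) //.
  rewrite (closer' z z') // (opener' z' z) // !inx !iny !eqxx !(negPf xNy) yx.
  rewrite (negPf ax) (negPf axy) (negPf ay) (negPf ayx) xs ys /cup_weight /=.
  by case: (z \in s); case: (z' \in s); rewrite /=; field.
Qed.

(** The two labels of the cup from x to y are opposite, so the sum over all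
    labellings splits into two sums over labellings of the other points. *)
Lemma sum_cup be (G : {set T} -> F) : link_state S be -> be x = y ->
  \sum_(s : {set T} | s \subset S) G s * state_weight S be s =
  \sum_(s : {set T} | s \subset S') (a^-1 * G (x |: s) + a * G (y |: s)) *
    state_weight S' be s.
Proof.
move=> L bx; have by_ : be y = x by rewrite -bx (linkK L).
(* Equal labels at both ends of the cup contribute zero. *)
have W0 s : (x \in s) = (y \in s) -> state_weight S be s = 0.
  move=> e; rewrite state_weight_split (site_weight_closer _ by_) //.
  by rewrite /cup_weight e eqxx mulr0 mul0r.
have half b (w := if b then x else y) (v := if b then y else x) :
  \sum_(s : {set T} | [&& s \subset S, w \in s & v \notin s])
      G s * state_weight S be s
  = \sum_(s : {set T} | s \subset S')
      ((if b then a^-1 else a) * G (w |: s)) * state_weight S' be s.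
  have wNv : v != w by rewrite /w /v; case: (b); rewrite // eq_sym.
  have inwv k : (k \in S') = [&& k != v, k != w & k \in S].
    by rewrite inS' /w /v; case: (b); rewrite // andbCA.
  have wS : w \in S by rewrite /w; case: (b).
  have sub s : (s \subset S') = [&& s \subset S, w \notin s & v \notin s].
    by rewrite !subsetD1 /w /v -andbA; case: (b) => //; congr (_ && _); rewrite andbC.
  rewrite (reindex_onto (fun s => w |: s) (fun s => s :\ w)) /=; last first.
    by move=> s /and3P[_ ws _]; rewrite setD1K.
  apply: eq_big => [s|s /andP[/and3P[sS _ vs] /eqP e]].
    rewrite sub setU11 in_setU1 (negPf wNv) /= subUset sub1set wS /=.
    have -> : ((w |: s) :\ w == s) = (w \notin s).
      by apply/eqP/idP => [<-|]; [rewrite !inE eqxx | exact: setU1K].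
    by rewrite -andbA; congr (_ && _); rewrite andbC.
  rewrite (state_weight_cup b L bx) ?mulrA 1?[G _ * _]mulrC //.
  rewrite sub -e !inE eqxx /=; move: sS vs.
  rewrite in_setU1 (negPf wNv) /= subUset => /andP[_ sS] vs.
  by rewrite e sS.
rewrite (bigID (fun s : {set T} => x \in s)) /=.
rewrite (bigID (fun s : {set T} => y \in s)) /= big1 ?add0r; last first.
  by move=> s /andP[/andP[_ xs] ys]; rewrite W0 ?mulr0 // xs ys.
rewrite [X in _ + X](bigID (fun s : {set T} => y \in s)) /=.
rewrite [X in _ + (_ + X)]big1 ?addr0; last first.
  by move=> s /andP[/andP[_ /negPf xs] /negPf ys]; rewrite W0 ?mulr0 // xs ys.
under [RHS]eq_bigr do rewrite mulrDl.
rewrite [RHS]big_split /= -(half true) -(half false).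
congr (_ + _); apply: eq_bigl => s; first by rewrite andbA.
by rewrite -andbA; congr (_ && _); rewrite andbC.
Qed.

(** The through strings keep their order: if the one at x is pushed along the arc
    at y, it passes no other through string, since none starts below a cup. *)
Lemma contract_defects al t (pa : 'I_t -> T) :
  link_state S al -> ~~ ((al x == x) && (al y == y)) ->
  enum_defects S al pa ->
  enum_defects S' (contract al x y)
    (fun i => if pa i == x then al y else if pa i == y then al x else pa i).
Proof.
move=> L nxy [paS paF paO paM].
have [xx yy] := (linkK L xS, linkK L yS).
have yNx : y != x by rewrite eq_sym.
have yNfix : al x = x -> [/\ al y != y, al y != x, al y \in S' & (y < al y)%N].
  move=> ax; have ay : al y != y by move: nxy; rewrite ax eqxx.
  have ayx : al y != x by apply: contra_neq xNy => e; rewrite -yy e ax.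
  split=> //; first by rewrite inS' ay ayx (link_in L).
  have := link_exposed L yS xS ax xNy; rewrite /separates ltyx /= -leqNgt => lxz.
  have := adj (link_in L yS); move: ay ayx lxz; rewrite -!val_eqE /=; lia.
have xNfix : al y = y -> [/\ al x != x, al x != y, al x \in S' & (al x < x)%N].
  move=> ay; have ax : al x != x by move: nxy; rewrite ay eqxx andbT.
  have axy : al x != y by apply: contra_neq xNy => e; rewrite -xx e ay.
  split=> //; first by rewrite inS' axy ax (link_in L).
  have := link_exposed L xS yS ay yNx; rewrite /separates xy /= negbK => lzy.
  have := adj (link_in L xS); move: ax axy lzy; rewrite -!val_eqE /=; lia.
split.
- move=> i; case: eqP => [e|/eqP nx].
    by have [] : [/\ al y != y, al y != x, al y \in S' & (y < al y)%N]
      by apply: yNfix; rewrite -e paF.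
  case: eqP => [e|/eqP ny]; last by rewrite inS' nx ny paS.
  by have [] : [/\ al x != x, al x != y, al x \in S' & (al x < x)%N]
    by apply: xNfix; rewrite -e paF.
- move=> i; case: eqP => [e|/eqP nx].
    by rewrite /contract yy (negPf yNx) eqxx -e paF eqxx.
  case: eqP => [e|/eqP ny]; last by rewrite /contract paF (negPf nx) (negPf ny).
  by rewrite /contract xx eqxx -e paF eqxx.
- move=> k kS; have [_ Ck] := contractP L kS.
  move: (kS); rewrite inS' => /and3P[ky kx kS0].
  case: Ck => [-> ax ay e|_ kx' xk yfix _|-> _ _ _ yk|_ ky' yk xfix _|-> _ _ _ xk].
  + have [i ei] := paO k kS0 e.
    by exists i; rewrite -ei (negPf kx) (negPf ky).
  + by have [i ei] := paO y yS yfix; exists i; rewrite -ei (negPf yNx) eqxx.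
  + by move=> e; rewrite e eqxx in yk.
  + by have [i ei] := paO x xS xfix; exists i; rewrite -ei eqxx.
  + by move=> e; rewrite e eqxx in xk.
move=> i j ij; have lt_ij := paM i j ij.
have [ei|ni] := eqVneq (pa i) x.
  have ax : al x = x by rewrite -ei paF.
  have [ay ayx zS ltz] := yNfix ax.
  have nx : pa j != x by rewrite -ei -val_eqE /= gtn_eqF.
  have ny : pa j != y by apply: contra_neq ay => <-.
  rewrite (negPf nx) (negPf ny); rewrite ei in lt_ij.
  exact: past_gap (adj (paS j)) ny (link_exposed L yS (paS j) (paF j) ny) lt_ij.
have [ei|ni'] := eqVneq (pa i) y.
  have ay : al y = y by rewrite -ei paF.
  have [ax axy zS ltz] := xNfix ay.
  have nx : pa j != x by apply: contra_neq ax => <-.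
  have ny : pa j != y by rewrite -ei -val_eqE /= gtn_eqF.
  rewrite (negPf nx) (negPf ny); rewrite ei in lt_ij.
  exact: ltn_trans ltz (ltn_trans xy lt_ij).
have [ej|nj] := eqVneq (pa j) x.
  have ax : al x = x by rewrite -ej paF.
  have [ay ayx zS ltz] := yNfix ax.
  rewrite ej in lt_ij; exact: ltn_trans lt_ij (ltn_trans xy ltz).
have [ej|nj'] //= := eqVneq (pa j) y.
have ay : al y = y by rewrite -ej paF.
have [ax axy zS ltz] := xNfix ay.
rewrite ej in lt_ij.
have nz : pa i != al x by apply: contra_neq ni => e; rewrite -paF e xx.
exact: before_gap (adj (paS i)) ni nz (link_exposed L xS (paS i) (paF i) ni) lt_ij.
Qed.

(** An invariant function on the remaining points extends to x and y by its value
    at a partner of either of them. *)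
Lemma contract_components (C : finType) al be (c : T -> C) :
  link_state S al -> link_state S be -> be x = y ->
  component_map S al be c -> component_map S' (contract al x y) be c.
Proof.
move=> L Lb bx [cal cbe csep].
have sub k : k \in S' -> k \in S by rewrite inS' => /and3P[].
have cxy : c x = c y by rewrite -bx cbe.
have by_ : be y = x by rewrite -bx (linkK Lb).
have [xx yy] := (linkK L xS, linkK L yS).
have beS k : k \in S' -> be k \in S'.
  by move=> kS; have [] := contractP Lb kS; rewrite (contract_cup Lb).
split.
- move=> k kS; have [_ Ck] := contractP L kS.
  case: Ck => [->|-> //|-> kx _ _ _|-> //|-> ky _ _ _]; first by rewrite cal // sub.
    by rewrite cal // -cxy -kx cal // sub.
  by rewrite cal // cxy -ky cal // sub.
- by move=> k kS; apply: cbe (sub _ kS).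
move=> f fal fbe k l kS lS ckl.
(* The value of f on the component of the contracted arc; it is arbitrary if
   this component has no other point. *)
pose v := if al x \in S' then f (al x) else if al y \in S' then f (al y) else false.
pose g m := if m \in S' then f m else v.
have gS m : m \in S' -> g m = f m by rewrite /g => ->.
have xN : (x \in S') = false by rewrite inS' eqxx andbF.
have yN : (y \in S') = false by rewrite inS' eqxx.
have [gx gy] : g x = v /\ g y = v by rewrite /g xN yN.
have galx : g (al x) = v by rewrite /g; case: ifP => // h; rewrite /v h.
have galy : g (al y) = v.
  rewrite /g; case: ifP => // h; rewrite /v h; case: ifP => // h'.
  have := fal _ h'; rewrite /contract xx eqxx; case: eqP => // ay.
  by rewrite ay yN in h.
suff: g k = g l by rewrite !gS.
apply: csep => //; try exact: sub.
- move=> m mS; have [->|mx] := eqVneq m x; first by rewrite galx.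
  have [->|my] := eqVneq m y; first by rewrite galy.
  have mS' : m \in S' by rewrite inS' mx my.
  have [emx|nx] := eqVneq (al m) x.
    by rewrite emx gx -galx -emx (linkK L).
  have [emy|ny] := eqVneq (al m) y.
    by rewrite emy gy -galy -emy (linkK L).
  have amS : al m \in S' by rewrite inS' nx ny (link_in L).
  by rewrite !gS // -(fal _ mS') /contract (negPf nx) (negPf ny).
- move=> m mS; have [->|mx] := eqVneq m x; first by rewrite bx gx gy.
  have [->|my] := eqVneq m y; first by rewrite by_ gx gy.
  have mS' : m \in S' by rewrite inS' mx my.
  by rewrite !gS ?beS ?fbe.
Qed.

End Contract.

(** A shortest cup is innermost: anything inside it would be part of a shorter
    cup or an enclosed through string. *)
(** * The state sum formula *)

Lemma innermost_cup S be : link_state S be ->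
  (forall k, k \in S -> be k = k) \/
  exists x, [/\ x \in S, (x < be x)%N & {in S, forall k : T, ~~ (x < k < be x)%N}].
Proof.
move=> L; have [/existsP[k0 /andP[k0S nk0]]|] := boolP [exists k in S, be k != k]; last first.
  move=> /existsPn h; left=> k kS; apply/eqP; have := h k.
  by rewrite kS negbK.
right; pose P x := (x \in S) && (x < be x)%N.
have [x0 Px0] : exists x0, P x0.
  have := nk0; rewrite -val_eqE neq_ltn => /orP[lt|lt].
    by exists (be k0); rewrite /P (link_in L) // (linkK L).
  by exists k0; rewrite /P k0S.
have [x /andP[xS ltx] xmin] := arg_minnP (fun x : T => (be x - x)%N) Px0.
exists x; split=> // k kS; apply/negP => /andP[xk ky].
have kx : k != x by rewrite -val_eqE /= gtn_eqF.
have kbx : k != be x by rewrite -val_eqE /= ltn_eqF.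
have sk : separates x (be x) k by rewrite /separates xk ltnNge (ltnW ky).
have bk : be k != k.
  by apply/eqP => e; have := link_exposed L xS kS e kx; rewrite sk.
have := link_noncross L xS kS kx kbx; rewrite sk /separates => sbk.
have bky : be k != be x.
  by apply: contra_neq kx => e; rewrite -(linkK L kS) e (linkK L).
have := xmin k; rewrite /P kS; have := xmin (be k); rewrite /P (link_in L) // (linkK L) //.
by move: bk bky sbk xk ky; rewrite -!val_eqE /=; clear; lia.
Qed.

Lemma enum_defects_uniq S al t (p p' : 'I_t -> T) :
  enum_defects S al p -> enum_defects S al p' -> p =1 p'.
Proof.
move=> E E'.
suff H m (i : 'I_t) : (i < m)%N -> p i = p' i by move=> i; apply: (H i.+1).
elim: m i => // m IH i im.
have half (r r' : 'I_t -> T) : enum_defects S al r -> enum_defects S al r' ->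
    (forall j : 'I_t, (j < i)%N -> r j = r' j) -> ~~ (r i < r' i)%N.
  move=> Er Er' e; apply/negP => lt.
  have [j ej] := defect_onto Er' (defect_in Er i) (defect_fix Er i).
  have [ji|ij] := ltnP j i.
    have := defect_mono Er ji; rewrite e // -ej ltnn //.
  move: ij; rewrite leq_eqVlt => /orP[/eqP/val_inj ij|ij].
    by move: lt; rewrite ej -ij ltnn.
  by have := ltn_trans lt (defect_mono Er' ij); rewrite ej ltnn.
have e (j : 'I_t) : (j < i)%N -> p j = p' j by move=> ji; apply: IH; apply: leq_trans ji im.
apply/val_inj; case: (ltngtP (p i) (p' i)) => // lt.
  by have := half _ _ E E' e; rewrite lt.
by have := half _ _ E' E (fun j ji => esym (e j ji)); rewrite lt.
Qed.

(** For use with [comp_sep]: the indicator of a component with two points. *)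
Lemma pair_stable S al x y : link_state S al ->
  al x \in [set x; y] -> al y \in [set x; y] ->
  {in S, forall k, (al k \in [set x; y]) = (k \in [set x; y])}.
Proof.
move=> L ax ay k kS; have stab l : l \in [set x; y] -> al l \in [set x; y].
  by rewrite {1}in_set2 => /orP[]/eqP->.
by apply/idP/idP => [/stab|/stab //]; rewrite (linkK L).
Qed.

(** Induction on the number of points, contracting an innermost cup of [be]
    against [al].  If [be] has no cup then counting fixed points shows that [al]
    has none either, and both sides are 1.  The first conclusion, that different
    through strings lie in different components once all of them match up, is
    carried along because [stack_id] needs it to identify the stacked diagram. *)
Theorem state_sum (C : finType) S al be t (pa pb : 'I_t -> T) (c : T -> C) :
  link_state S al -> link_state S be ->
  enum_defects S al pa -> enum_defects S be pb ->
  component_map S al be c ->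
  ((forall i, c (pa i) = c (pb i)) -> injective (c \o pb)) /\
  \sum_(s : {set T} | s \subset S) state_weight S al s * state_weight S be s =
    if [forall i, c (pa i) == c (pb i)]
    then loop_weight ^+ #|(c @: S) :\: [set c (pb i) | i : 'I_t]| else 0.
Proof.
have [m] := ubnP #|S|; elim: m S al pa => // m IH S al pa ltSm L Lb Ea Eb Cc.
have [befix|[x [xS xy adj]]] := innermost_cup Lb.
  have pbS : [set pb i | i : 'I_t] = S.
    apply/setP => k; apply/imsetP/idP => [[i _ ->]|kS]; first exact: defect_in Eb i.
    by have [i ei] := defect_onto Eb kS (befix k kS); exists i.
  have injE al' (p : 'I_t -> T) : enum_defects S al' p -> injective p.
    by move=> E i j e; apply/val_inj; case: (ltngtP i j) => // /(defect_mono E);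
      rewrite e ltnn.
  have paS : [set pa i | i : 'I_t] = S.
    apply/eqP; rewrite eqEcard; apply/andP; split.
      by apply/subsetP => k /imsetP[i _ ->]; apply: defect_in Ea i.
    by rewrite -pbS (card_imset _ (injE _ _ Ea)) (card_imset _ (injE _ _ Eb)).
  have alfix k : k \in S -> al k = k.
    by rewrite -paS => /imsetP[i _ ->]; apply: defect_fix Ea i.
  have Eb' : enum_defects S al pb.
    split; [exact: defect_in Eb | | | exact: defect_mono Eb].
      by move=> i; apply/alfix/(defect_in Eb).
    by move=> k kS _; apply: (defect_onto Eb) (befix k kS).
  have papb := enum_defects_uniq Ea Eb'.
  split.
    move=> _ i j /= e; apply: (injE _ _ Eb); apply/eqP.
    have := comp_sep Cc (f := pred1 (pb j)) _ _ (defect_in Eb i) (defect_in Eb j) e.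
    rewrite /= eqxx => -> // k kS; first by rewrite alfix.
    by rewrite befix.
  have -> : [forall i, c (pa i) == c (pb i)] by apply/forallP => i; rewrite papb.
  have -> : (c @: S) :\: [set c (pb i) | i : 'I_t] = set0.
    apply/eqP; rewrite setD_eq0; apply/subsetP => _ /imsetP[k + ->].
    by rewrite -pbS => /imsetP[i _ ->]; apply: imset_f.
  rewrite cards0 expr0 (bigD1 set0) ?sub0set //= big1 ?addr0.
    rewrite /state_weight !big1 ?mulr1 // => k kS; rewrite site_weight_defect ?in_set0 //.
    exact: befix. exact: alfix.
  move=> s /andP[sS]; case/set0Pn => k ks; have kS := subsetP sS k ks.
  by rewrite [X in _ * X]/state_weight (big_setD1 k) //= site_weight_defect ?befix // ks mul0r mulr0.
set y := be x in xy adj.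
have yS : y \in S := link_in Lb xS.
have bx : be x = y by [].
have by_ : be y = x := linkK Lb xS.
have xNy : x != y by rewrite -val_eqE /= ltn_eqF.
have yNx : y != x by rewrite eq_sym.
have [xx yy] := (linkK L xS, linkK L yS).
have cxy : c x = c y by rewrite /y (comp_be Cc).
rewrite (sum_cup xS yS xy _ Lb bx).
under eq_bigr => s sS do rewrite (state_weight_contract xS yS xy adj L sS) -mulrA.
rewrite -mulr_sumr.
set S' := S :\ x :\ y.
have inS' k : (k \in S') = [&& k != y, k != x & k \in S] by rewrite !inE.
have pbN i : pb i != x /\ pb i != y.
  split; apply: contra_neq xNy => e.
    by rewrite -bx -e (defect_fix Eb).
  by rewrite -by_ -e (defect_fix Eb).
have [/andP[/eqP ax /eqP ay]|nxy] := boolP ((al x == x) && (al y == y)).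
  rewrite ax (negPf xNy) mul0r.
  have [i ei] := defect_onto Ea xS ax.
  have ncond : c (pa i) <> c (pb i).
    move=> e; have := comp_sep Cc (f := mem [set x; y]) _ _ (defect_in Ea i) (defect_in Eb i) e.
    rewrite -ei /= !inE eqxx /=; have [/negPf-> /negPf->] := pbN i.
    move=> h; suff: true = false by []; apply: h; apply: pair_stable => //;
      by rewrite !inE ?ax ?ay ?bx ?by_ eqxx ?orbT.
  split=> [h|]; first by case: ncond; apply: h.
  by case: forallP => // /(_ i)/eqP.
have Ea' := contract_defects xS yS xy adj L nxy Ea.
have L' := contract_link xS yS xy adj L.
have Lb' : link_state S' be.
  apply: (link_state_ext (al := contract be x y)); last exact: contract_link.
  exact: contract_cup.
have Cc' := contract_components xS yS xy L Lb bx Cc.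
have Eb' : enum_defects S' be pb.
  split.
  - by move=> i; rewrite inS' (pbN i).1 (pbN i).2 (defect_in Eb).
  - exact: defect_fix Eb.
  - by move=> k; rewrite inS' => /and3P[_ _ kS]; apply: defect_onto Eb k kS.
  - exact: defect_mono Eb.
have ltS' : (#|S'| < m)%N.
  apply: leq_trans _ (_ : #|S| <= m)%N; last by rewrite -ltnS.
  by rewrite [X in (_ < X)%N](cardsD1 x) xS (cardsD1 y (S :\ x)) !inE yNx yS /= -/S' ltnS leq_addl.
have [IH1 IH2] := IH S' _ _ ltS' L' Lb' Ea' Eb' Cc'.
set pa' := (fun i => _) in Ea' IH1 IH2.
have cpa i : c (pa' i) = c (pa i).
  rewrite /pa'; case: eqP => [->|_]; first by rewrite (comp_al Cc) // cxy.
  by case: eqP => [->|//]; rewrite (comp_al Cc) // cxy.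
have eqc : [forall i, c (pa' i) == c (pb i)] = [forall i, c (pa i) == c (pb i)].
  by apply: eq_forallb => i; rewrite cpa.
split; first by move=> h; apply: IH1 => i; rewrite cpa.
rewrite IH2 eqc.
case: [forall i, c (pa i) == c (pb i)]; last by rewrite mulr0.
have cS : c @: S = c x |: c @: S'.
  apply/setP => d; rewrite in_setU1; apply/imsetP/idP.
    move=> [k kS ->]; have [->|kx] := eqVneq k x; first by rewrite eqxx.
    have [->|ky] := eqVneq k y; first by rewrite cxy eqxx.
    by apply/orP; right; apply: imset_f; rewrite inS' kx ky.
  case/predU1P => [->|/imsetP[k + ->]]; first by exists x.
  by rewrite inS' => /and3P[_ _ kS]; exists k.
have [axy|axy] := eqVneq (al x) y.
  (* The closed loop through x and y is a component of its own. *)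
  have cxN k : k \in S' -> c k != c x.
    move=> kS'; move: (kS'); rewrite inS' => /and3P[ky kx kS]; apply/eqP => e.
    have := comp_sep Cc (f := mem [set x; y]) _ _ kS xS e.
    rewrite /= !inE eqxx (negPf ky) (negPf kx) /= => h; have := h _ _ => {h} h.
    have ayx : al y = x by rewrite -axy.
    suff: false by []; apply: h; apply: pair_stable => //;
      by rewrite !inE ?axy ?ayx ?bx ?by_ eqxx ?orbT.
  rewrite -exprS; congr (_ ^+ _).
  rewrite cS setDUl.
  have -> : [set c x] :\: [set c (pb i) | i : 'I_t] = [set c x].
    apply/setDidPl; rewrite disjoints1; apply/imsetP => -[i _ e].
    by have := cxN _ (defect_in Eb' i); rewrite e eqxx.
  have cN : c x \in c @: S' = false.
    by apply/imsetP => -[k kS e]; have := cxN k kS; rewrite e eqxx.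
  by rewrite cardsU1 in_setD cN andbF.
rewrite mul1r cS; congr (_ ^+ #|pred_of_set (_ :\: _)|).
apply/esym/setUidPr; rewrite sub1set.
have [ax|ax] := eqVneq (al x) x.
  rewrite cxy -(comp_al Cc yS); apply: imset_f; rewrite inS' (link_in L) // andbT.
  move: nxy; rewrite ax eqxx /= => -> /=.
  by apply: contra_neq xNy => e; rewrite -yy e ax.
rewrite -(comp_al Cc xS); apply: imset_f.
by rewrite inS' (link_in L) // andbT axy ax.
Qed.
End Contraction.

(** * The pairing of two diagrams as a state sum *)

(** The top half of a diagram as a link state. *)
Definition arc_map t n (D : wiring t n) (k : 'I_n) : 'I_n :=
  if D (inr k) is inr l then l else k.

Section Diagram.
Variables (t n : nat) (D : wiring t n).
Hypotheses (tlD : is_tl_diagram D) (monD : Defs.monic D).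

Lemma wiringK x : D (D x) = x.
Proof. by case/andP: tlD => /forallP/(_ x)/andP[_ /eqP]. Qed.

Lemma wiring_neq x : D x != x.
Proof. by case/andP: tlD => /forallP/(_ x)/andP[]. Qed.

Lemma wiring_noncross x y :
  ~~ [&& (boundary_pos x < boundary_pos y)%N,
         (boundary_pos y < boundary_pos (D x))%N
       & (boundary_pos (D x) < boundary_pos (D y))%N].
Proof. by case/andP: tlD => _ /forallP/(_ x)/forallP/(_ y). Qed.

(** Boundary positions decrease along the top, hence the reversed inequalities. *)
Lemma top_cross (u v u' v' : 'I_n) : D (inr u) = inr u' -> D (inr v) = inr v' ->
  ~~ [&& (v' < u')%N, (u' < v)%N & (v < u)%N].
Proof.
move=> eu ev; have := wiring_noncross (inr u) (inr v); rewrite eu ev /=.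
by have := ltn_ord u; have := ltn_ord v; have := ltn_ord u'; clear; lia.
Qed.

Lemma arc_mapP k : (exists2 i, D (inr k) = inl i & arc_map D k = k) \/
  (D (inr k) = inr (arc_map D k) /\ arc_map D k != k).
Proof.
rewrite /arc_map; case e: (D (inr k)) => [i|l]; first by left; exists i.
by right; split=> //; apply: contra_neq (wiring_neq (inr k)) => lk; rewrite e lk.
Qed.

Lemma arc_mapK : involutive (arc_map D).
Proof.
move=> k; have [[i _ e]|[e _]] := arc_mapP k; first by rewrite !e.
by rewrite {1}/arc_map -e wiringK.
Qed.

Lemma arc_link : link_state [set: 'I_n] (arc_map D).
Proof.
split=> [k _|k _|k u _ _ uk uk'|k u _ _ eu uk]; first by rewrite inE.
- exact: arc_mapK.
- have [[i _ ->]|[ek nk]] := arc_mapP k; first by rewrite !separates_refl.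
  have [[i _ ->//]|[eu nu]] := arc_mapP u.
  have ek' := wiringK (inr k); rewrite ek in ek'.
  have eu' := wiringK (inr u); rewrite eu in eu'.
  have uk2 : arc_map D u != k.
    by apply: contra_neq uk' => <-; rewrite arc_mapK.
  have uk3 : arc_map D u != arc_map D k.
    by apply: contra_neq uk => e; rewrite -(arc_mapK u) e arc_mapK.
  have := top_cross ek eu; have := top_cross ek eu'.
  have := top_cross ek' eu; have := top_cross ek' eu'.
  have := top_cross eu ek; have := top_cross eu ek'.
  have := top_cross eu' ek; have := top_cross eu' ek'.
  move: (arc_map D u) (arc_map D k) uk uk' uk2 uk3 nk nu => u' k'.
  by rewrite /separates -!val_eqE /=; clear; lia.
have [[i _ ->]|[ek nk]] := arc_mapP k; first by rewrite separates_refl.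
have [[i ei _]|[_]] := arc_mapP u; last by rewrite eu eqxx.
have ek' := wiringK (inr k); rewrite ek in ek'.
have ei' := wiringK (inr u); rewrite ei in ei'.
have := wiring_noncross (inl i) (inr k); rewrite ei' ek /=.
have := wiring_noncross (inl i) (inr (arc_map D k)); rewrite ei' ek' /=.
have := ltn_ord u; have := ltn_ord k; have := ltn_ord i; have := ltn_ord (arc_map D k).
have uk' : u != arc_map D k by apply/eqP => e; move: ek'; rewrite -e ei.
by move: uk uk' nk; rewrite /separates -!val_eqE /=; clear; lia.
Qed.

Lemma through_mapE : exists p : 'I_t -> 'I_n, forall i, D (inl i) = inr (p i).
Proof.
have : forall i, exists k, D (inl i) = inr k.
  move=> i; move/forallP: monD => /(_ i).
  by case: (D (inl i)) => // k _; exists k.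
by move=> /fin_all_exists.
Qed.

Lemma arc_defects p : (forall i, D (inl i) = inr (p i)) ->
  enum_defects [set: 'I_n] (arc_map D) p.
Proof.
move=> ep; have ep' i : D (inr (p i)) = inl i by rewrite -ep wiringK.
split=> [i|i|k _ ek|i j ij]; first by rewrite inE.
- by rewrite /arc_map ep'.
- have [[i ei _]|[_]] := arc_mapP k; last by rewrite ek eqxx.
  by exists i; have := wiringK (inr k); rewrite ei ep => -[].
have := wiring_noncross (inl i) (inl j); rewrite !ep /=.
have : p i != p j by apply: contraTneq ij => e; have := ep' i; rewrite e ep' => -[->]; rewrite ltnn.
have := ltn_ord (p i); have := ltn_ord (p j); have := ltn_ord j.
by move: ij; rewrite -val_eqE /=; clear; lia.
Qed.
End Diagram.

Section Pairing.
Variables (F : fieldType) (a q : F).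
Hypotheses (a_neq0 : a != 0) (loopE : loop_value q = loop_weight a).
Variables (t n : nat) (D1 D2 : wiring t n).
Hypotheses (tl1 : is_tl_diagram D1) (tl2 : is_tl_diagram D2).

Let e := stack_edge (reflect_wiring D1) D2.
Let c (k : 'I_n) : stack_point t n t := fingraph.root e (inr k).

Let e_sym : symmetric e.
Proof.
move=> u v; apply/idP/idP.
  all: case/orP=> /existsP[x /andP[/eqP-> /eqP->]]; apply/orP; [left|right].
  all: apply/existsP.
  all: try by exists (D2 x); rewrite wiringK // !eqxx.
  all: exists (reflect_wiring D1 x); rewrite !ffunE.
  all: have sw (y : point t n) : swap (swap y) = y by case: y.
  all: have sw' (y : point n t) : swap (swap y) = y by case: y.
  all: by rewrite sw wiringK // sw' !eqxx.
Qed.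

Let con_sym : connect_sym e.
Proof. exact: sym_connect_sym. Qed.

Let e_lower x : e (lower_point t x) (lower_point t (D2 x)).
Proof. by apply/orP; left; apply/existsP; exists x; rewrite !eqxx. Qed.

Let e_upper x : e (upper_point t (swap x)) (upper_point t (swap (D1 x))).
Proof.
apply/orP; right; apply/existsP; exists (swap x); rewrite !ffunE.
have -> : swap (swap x) = x by case: x.
by rewrite !eqxx.
Qed.

Variables p1 p2 : 'I_t -> 'I_n.
Hypotheses (ep1 : forall i : 'I_t, D1 (inl i) = inr (p1 i)).
Hypotheses (ep2 : forall i : 'I_t, D2 (inl i) = inr (p2 i)).

Let bottom (i : 'I_t) : stack_point t n t := inl (inl i).
Let top (i : 'I_t) : stack_point t n t := inl (inr i).

Let con_bottom i : connect e (bottom i) (inr (p2 i)).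
Proof. by apply: connect1; have := e_lower (inl i); rewrite ep2. Qed.

Let con_top i : connect e (top i) (inr (p1 i)).
Proof. by apply: connect1; have := e_upper (inl i); rewrite ep1. Qed.

Let con_c k l : (c k == c l) = connect e (inr k) (inr l).
Proof. exact: root_connect. Qed.

Let con_bottom_c i k : connect e (bottom i) (inr k) = (c (p2 i) == c k).
Proof. by rewrite con_c; apply: same_connect. Qed.

Let con_top_c i k : connect e (top i) (inr k) = (c (p1 i) == c k).
Proof. by rewrite con_c; apply: same_connect. Qed.

(** A function that is constant along the arcs extends to the outer points of the
    stacked graph through the top points to which they are attached. *)
Lemma stack_components :
  component_map [set: 'I_n] (arc_map D1) (arc_map D2) c.
Proof.
split.
- move=> k _; apply/eqP; rewrite con_c con_sym.
  have [[i _ ->]|[ek _]] := arc_mapP tl1 k; first exact: connect0.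
  by apply: connect1; have := e_upper (inr k); rewrite ek.
- move=> k _; apply/eqP; rewrite con_c con_sym.
  have [[i _ ->]|[ek _]] := arc_mapP tl2 k; first exact: connect0.
  by apply: connect1; have := e_lower (inr k); rewrite ek.
move=> f f1 f2 k l _ _ /eqP; rewrite con_c => /connectP[s es el].
pose g (u : stack_point t n t) := match u with
  | inl (inl i) => f (p2 i) | inl (inr i) => f (p1 i) | inr m => f m end.
have ge u v : e u v -> g u = g v.
  case/orP=> /existsP[x /andP[/eqP-> /eqP->]].
    case: x => [i|m]; first by rewrite ep2.
    have [[i em _]|[em _]] := arc_mapP tl2 m; last by rewrite em /= f2.
    by rewrite em /=; have := wiringK tl2 (inr m); rewrite em ep2 => -[->].
  rewrite !ffunE; case: x => [m|i] /=; last by rewrite ep1.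
  have [[i em _]|[em _]] := arc_mapP tl1 m; last by rewrite em /= f1.
  by rewrite em /=; have := wiringK tl1 (inr m); rewrite em ep1 => -[->].
have gs u s' : path e u s' -> g u = g (last u s').
  by elim: s' u => //= v s' IH u /andP[/ge-> /IH].
by have := gs _ _ es; rewrite -el.
Qed.

(** A picked partner of an outer point can only be the expected one: any other
    outer point would connect two different through strings. *)
Lemma stack_id : ((forall i, c (p1 i) = c (p2 i)) -> injective (c \o p2)) ->
  (stack (reflect_wiring D1) D2 == id_wiring t)
    = [forall i, c (p1 i) == c (p2 i)].
Proof.
move=> inj; apply/eqP/forallP => [st i|cond].
  move/ffunP: st => /(_ (inl i)).
  rewrite !ffunE; case: pickP => [y /andP[_ con] /= ey|//].
  rewrite ey -/e -/(bottom i) -/(top i) in con.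
  have := connect_trans con (con_top i).
  by rewrite con_bottom_c eq_sym.
have cond' i : c (p1 i) = c (p2 i) by apply/eqP.
have {}inj := inj cond'.
apply/ffunP => x; rewrite !ffunE -/e; case: pickP => [y /andP[yx con]|none] /=.
  case: x con yx => i; case: y => j con yx; rewrite -/(bottom _) -/(top _) in con.
  - have := connect_trans con (con_bottom j); rewrite con_bottom_c => /eqP/inj ij.
    by rewrite ij eqxx in yx.
  - have := connect_trans con (con_top j); rewrite con_bottom_c cond'.
    by move=> /eqP/inj ->.
  - have := connect_trans con (con_bottom j); rewrite con_top_c cond'.
    by move=> /eqP/inj ->.
  have := connect_trans con (con_top j); rewrite con_top_c !cond'.
  by move=> /eqP/inj ij; rewrite ij eqxx in yx.
case: x none => i none.
  have := none (inr i); rewrite /= -/(bottom i) -/(top i) => /negP[].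
  apply: connect_trans (con_bottom i) _; rewrite con_sym con_top_c //.
have := none (inl i); rewrite /= -/(bottom i) -/(top i) => /negP[].
by apply: connect_trans (con_top i) _; rewrite con_sym con_bottom_c eq_sym.
Qed.

(** Every component of the stacked graph that avoids the outer points consists of
    middle points, and a component reaches an outer point as soon as it contains
    the top of a through string. *)
Lemma closed_loopsE : (forall i, c (p1 i) = c (p2 i)) ->
  closed_loops (reflect_wiring D1) D2
    = #|(c @: [set: 'I_n]) :\: [set c (p2 i) | i : 'I_t]|.
Proof.
move=> cond; rewrite /closed_loops -/e /n_comp_mem; apply: eq_card => r; rewrite !inE.
apply/andP/andP => [[/eqP rr out]|[nout /imsetP[k _ er]]].
  case: r rr out => [x|k] rr out.
    by case/negP: out; apply/existsP; exists x; apply: connect0.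
  split; last by apply/imsetP; exists k; rewrite ?inE // /c rr.
  apply: contra out => /imsetP[i _ ek]; apply/existsP; exists (inl i).
  rewrite con_sym -/(bottom i) con_bottom_c -ek; apply/eqP.
  by rewrite /c rr.
rewrite {r}er in nout *; split; first by apply/eqP; exact: root_root.
apply: contra nout => /existsP[x con]; apply/imsetP.
have con' : connect e (inl x) (inr k).
  by rewrite con_sym; apply: connect_trans con; apply: connect_root.
case: x con' {con} => i; rewrite -?/(bottom i) -?/(top i).
  by rewrite con_bottom_c => /eqP ek; exists i => //; exact: esym ek.
by rewrite con_top_c cond => /eqP ek; exists i => //; exact: esym ek.
Qed.

Lemma pairing_state_sum :
  pairing q D1 D2 = \sum_(s : {set 'I_n})
    state_weight a [set: 'I_n] (arc_map D1) s
      * state_weight a [set: 'I_n] (arc_map D2) s.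
Proof.
have [inj sumE] := state_sum a_neq0 (arc_link tl1) (arc_link tl2)
  (arc_defects tl1 ep1) (arc_defects tl2 ep2) stack_components.
transitivity (\sum_(s : {set 'I_n} | s \subset [set: 'I_n])
  state_weight a setT (arc_map D1) s * state_weight a setT (arc_map D2) s).
  rewrite sumE /pairing stack_id //; case: forallP => // cond.
  by rewrite closed_loopsE ?loopE // => i; apply/eqP.
by apply: eq_bigl => s; rewrite subsetT.
Qed.
End Pairing.

(** * Words, stacks and the entries of tensor matrices *)

(** The stack of the points that are still unmatched after the first m letters of
    the word g, where g k tells that the point k is the right end of a cup. *)
Fixpoint open_stack (g : nat -> bool) m : seq nat :=
  if m is k.+1 then
    if g k then behead (open_stack g k) else k :: open_stack g k
  else [::].

Fixpoint well_formed (g : nat -> bool) m : bool :=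
  if m is k.+1 then well_formed g k && (g k ==> (open_stack g k != [::]))
  else true.

(** A link state on the points 0, ..., n-1, as a function on natural numbers, so
    that it can be extended to more points. *)
Record nat_link (n : nat) (A : nat -> nat) : Prop := NatLink {
  nat_link_lt : forall k, (k < n)%N -> (A k < n)%N;
  nat_linkK : forall k, (k < n)%N -> A (A k) = k;
  nat_link_noncross : forall k u, (k < n)%N -> (u < n)%N -> u != k -> u != A k ->
    separates k (A k) (A u) = separates k (A k) u;
  nat_link_exposed : forall k u, (k < n)%N -> (u < n)%N -> A u = u -> u != k ->
    ~~ separates k (A k) u }.

Section Scan.
Variables (n : nat) (A : nat -> nat) (g : nat -> bool).
Hypotheses (LA : nat_link n A) (gA : forall k, (k < n)%N -> g k = (A k < k)%N).

(** Tells for k < m whether k is still open after the first m points. *)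
Definition unmatched m k := (A k == k) || (m <= A k)%N.

(** The partner of a point m that closes a cup is the last unmatched point: by
    planarity every point below the cup is matched below it. *)
Lemma closer_split m : (m < n)%N -> g m ->
  [seq k <- iota 0 m | unmatched m k]
    = rcons [seq k <- iota 0 m.+1 | unmatched m.+1 k] (A m).
Proof.
move=> mn gm; have zm : (A m < m)%N by rewrite -gA.
set z := A m in zm *; have zn : (z < n)%N := ltn_trans zm mn.
have Az : A z = m by rewrite /z (nat_linkK LA).
have AA k : (k < n)%N -> A k = m -> k = z by move=> kn e; rewrite -(nat_linkK LA kn) e.
have -> : iota 0 m.+1 = iota 0 z ++ z :: iota z.+1 (m - z.+1) ++ [:: m].
  have -> : m.+1 = (z + ((m - z.+1).+1 + 1))%N by lia.
  rewrite iotaD add0n iotaD /= -cat_cons; congr (_ ++ (_ :: _ ++ [:: _])); lia.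
have -> : iota 0 m = iota 0 z ++ z :: iota z.+1 (m - z.+1).
  by rewrite -[X in iota 0 X = _](subnKC (ltnW zm)) iotaD add0n -subnSK.
have mid k : (z < k < m)%N -> unmatched m k = false /\ unmatched m.+1 k = false.
  move=> /andP[zk km]; have kn := ltn_trans km mn.
  have km' : k != m by rewrite ltn_eqF. have kz : k != z by rewrite gtn_eqF.
  have sk : separates m z k by rewrite /separates zk ltnNge (ltnW km).
  have nk : A k != k.
    by apply/eqP => e; have := nat_link_exposed LA mn kn e km'; rewrite -/z sk.
  have := nat_link_noncross LA mn kn km' kz; rewrite -/z sk /separates => sAk.
  have Akm : A k != m by apply: contra_neq kz => /AA->.
  by rewrite /unmatched (negPf nk) /=; move: sAk Akm; clear -zm; lia.
rewrite !filter_cat /= filter_cat /= [unmatched m z]/unmatched Az leqnn orbT.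
have -> : unmatched m.+1 z = false by rewrite /unmatched Az ltnn (gtn_eqF zm).
have -> : unmatched m.+1 m = false.
  by rewrite /unmatched -/z (ltn_eqF zm) ltnNge (ltnW zm).
have -> : [seq k <- iota z.+1 (m - z.+1) | unmatched m k] = [::].
  apply/eqP; rewrite -size_eq0 size_filter -leqn0 leqNgt -has_count.
  apply/hasPn => k; rewrite mem_iota => kz; have [|-> //] := mid k.
  by move: kz; clear -zm; lia.
have -> : [seq k <- iota z.+1 (m - z.+1) | unmatched m.+1 k] = [::].
  apply/eqP; rewrite -size_eq0 size_filter -leqn0 leqNgt -has_count.
  apply/hasPn => k; rewrite mem_iota => kz; have [|_ -> //] := mid k.
  by move: kz; clear -zm; lia.
rewrite !cats0 cats1; congr rcons; apply: eq_in_filter => k.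
rewrite mem_iota add0n /= => kz; rewrite /unmatched; congr (_ || _).
rewrite [RHS]ltn_neqAle; case: (m =P A k) => // e.
have kn := ltn_trans kz zn.
by move: kz; rewrite (AA k kn (esym e)) ltnn.
Qed.

Lemma opener_split m : (m < n)%N -> ~~ g m ->
  [seq k <- iota 0 m.+1 | unmatched m.+1 k]
    = rcons [seq k <- iota 0 m | unmatched m k] m.
Proof.
move=> mn gm; have zm : (m <= A m)%N by rewrite leqNgt -gA.
rewrite -addn1 iotaD filter_cat add0n /= /unmatched -cats1; congr (_ ++ _).
  apply: eq_in_filter => k; rewrite mem_iota add0n /= => km.
  congr (_ || _); rewrite addn1 [LHS]ltn_neqAle; case: (m =P A k) => // e.
  have := nat_linkK LA (ltn_trans km mn); rewrite -e => ek.
  by move: km; rewrite -ek ltnNge zm.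
by rewrite addn1 [(m < _)%N]ltn_neqAle zm andbT eq_sym orbN.
Qed.

(** Scanning the word of a link state from left to right recovers the link state. *)
Lemma open_stackE m : (m <= n)%N ->
  open_stack g m = rev [seq k <- iota 0 m | unmatched m k].
Proof.
elim: m => [//|m IH] mn; rewrite [open_stack _ _]/= (IH (ltnW mn)).
case: ifP => gm; first by rewrite closer_split // rev_rcons.
by rewrite opener_split ?gm // rev_rcons.
Qed.

Lemma scan_well_formed m : (m <= n)%N -> well_formed g m.
Proof.
elim: m => [//|m IH] mn /=; rewrite (IH (ltnW mn)) /=; apply/implyP => gm.
by rewrite (open_stackE (ltnW mn)) closer_split // rev_rcons.
Qed.

Lemma head_open_stack k : (k < n)%N -> g k -> head 0 (open_stack g k) = A k.
Proof. by move=> kn gk; rewrite (open_stackE (ltnW kn)) closer_split // rev_rcons. Qed.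

Lemma final_stackE : open_stack g n = rev [seq k <- iota 0 n | A k == k].
Proof.
rewrite open_stackE //; congr rev; apply: eq_in_filter => k.
rewrite mem_iota add0n /= => kn; rewrite /unmatched leqNgt (nat_link_lt LA kn).
by rewrite orbF.
Qed.
End Scan.

Section Entries.
Variables (F : fieldType) (a : F).
Implicit Types (r s g : nat -> bool).

(** The coordinate of the basis vector with the given labels, read from the last
    tensor factor to the first. *)
Fixpoint label_index m s : 'I_(d m) :=
  if m is k.+1 then
    if s k then rshift (d k) (label_index k s) else lshift (d k) (label_index k s)
  else ord0.

Fixpoint matches_labels (st : seq nat) r s : bool :=
  if st is z :: st' then (r (size st') == s z) && matches_labels st' r s else true.

(** The coefficient of all cups of the word g; the partner of k is on top of the
    stack when k is read. *)
Definition closer_weight g s m : F :=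
  \prod_(k < m | g k) cup_weight a (s (head 0%N (open_stack g k))) (s k).

Lemma label_index_ext m s s' : (forall k, (k < m)%N -> s k = s' k) ->
  label_index m s = label_index m s'.
Proof.
elim: m => //= m IH e; rewrite e // (IH) // => k km.
by apply: e; rewrite ltnW.
Qed.

Lemma matches_labels_ext st r r' s : (forall k, (k < size st)%N -> r k = r' k) ->
  matches_labels st r s = matches_labels st r' s.
Proof.
elim: st => //= z st IH e; rewrite e // (IH) // => k km.
by apply: e; rewrite ltnW.
Qed.

(** The state sum formula for diagrams whose bottom points carry arbitrary
    labels r; arbitrary labels are needed because closing a cup turns a bottom
    point into an inner one. *)
Lemma tensor_mx_entry g m t r s :
  tensor_mx a g m t (label_index t r) (label_index m s) =
  if well_formed g m && (size (open_stack g m) == t)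
  then (matches_labels (open_stack g m) r s)%:R * closer_weight g s m else 0.
Proof.
elim: m t r => [|m IH] t r.
  case: t => [|t] /=; first by rewrite mxE /= /closer_weight big_ord0 mulr1.
  by rewrite mxE.
have wS : closer_weight g s m.+1 = closer_weight g s m *
   (if g m then cup_weight a (s (head 0%N (open_stack g m))) (s m) else 1).
  by rewrite /closer_weight big_mkcond big_ord_recr /= -big_mkcond.
have [cl|op] := boolP (g m); last first.
  case: t => [|t]; first by rewrite tensor_open0 // mxE /= (negPf op) andbF.
  rewrite tensor_open // wS (negPf op) mulr1 [label_index t.+1 r]/=.
  rewrite [label_index m.+1 s]/= [well_formed _ _]/= [open_stack g m.+1]/= (negPf op).
  rewrite /= eqSS andbT.
  have IHt := IH t r.
  case er: (r t); case es: (s m);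
    rewrite ?block_mxEdr ?block_mxEdl ?block_mxEur ?block_mxEul ?IHt.
  1,4: by case: ifP => // /andP[_ /eqP ->]; rewrite er.
  1,2: by rewrite mxE; case: ifP => // /andP[_ /eqP ->]; rewrite er mul0r.
have [U [D e]] := tensor_vsplit a g m t.
rewrite (tensor_close cl e) wS cl [label_index m.+1 s]/=.
rewrite [well_formed _ _]/= [open_stack g m.+1]/= cl.
pose r' b k := if k == t then b else r k.
have r'E b : label_index t (r' b) = label_index t r.
  by apply: label_index_ext => k kt; rewrite /r' ltn_eqF.
have IH' b := IH t.+1 (r' b); rewrite e /= in IH'.
(* The label b of the bottom point that the new cup uses up is carried by the
   point on top of the stack. *)
have main b : (if b then D else U) (label_index t r) (label_index m s) =
  if well_formed g m && (size (open_stack g m) == t.+1)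
  then (matches_labels (open_stack g m) (r' b) s)%:R * closer_weight g s m else 0.
  rewrite -IH' r'E /r' eqxx.
  by case: b; rewrite ?col_mxEd ?col_mxEu.
have main' b : (if b then D else U) (label_index t r) (label_index m s) =
  if [&& well_formed g m, open_stack g m != [::] &
         size (behead (open_stack g m)) == t]
  then ((b == s (head 0%N (open_stack g m))) && matches_labels (behead (open_stack g m)) r s)%:R
       * closer_weight g s m else 0.
  rewrite main; case: (open_stack g m) => [|z st] /=; first by rewrite andbF.
  rewrite eqSS; case: ifP => // /andP[_ /eqP es].
  rewrite {1}/r' es eqxx (matches_labels_ext (r' := r)) // => k.
  by rewrite es => kt; rewrite /r' ltn_eqF.
rewrite -andbA /=; case es: (s m).
  rewrite row_mxEr mxE (main' false) /cup_weight.
  case: ifP => _; last by rewrite mulr0.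
  by case: (s _) => /=; ring.
rewrite row_mxEl mxE (main' true) /cup_weight.
case: ifP => _; last by rewrite mulr0.
by case: (s _) => /=; ring.
Qed.

Lemma all_up_entry t j : all_up F t ord0 j = (j == label_index t xpred0)%:R.
Proof.
elim: t j => [|t IH] j /=; first by rewrite mxE [j]ord1.
case: (split_ordP j) => k ->.
  by rewrite row_mxEl IH (inj_eq (@lshift_inj _ _)).
by rewrite row_mxEr mxE eq_rlshift.
Qed.

Lemma state_vector_entry g m t s :
  (all_up F t *m tensor_mx a g m t) ord0 (label_index m s) =
  if well_formed g m && (size (open_stack g m) == t)
  then (all (fun k => ~~ s k) (open_stack g m))%:R * closer_weight g s m else 0.
Proof.
rewrite mxE (bigD1 (label_index t xpred0)) //= big1 ?addr0; last first.
  by move=> j /negPf nj; rewrite all_up_entry nj mul0r.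
rewrite all_up_entry eqxx mul1r tensor_mx_entry; case: ifP => // _.
congr ((nat_of_bool _)%:R * _).
by elim: (open_stack g m) => //= z st ->; case: (s z).
Qed.

End Entries.

(** * The pairing as a dot product of state vectors *)

Definition arc_nat t n (D : wiring t n) (k : nat) : nat :=
  if insub k is Some i then val (arc_map D i) else k.

Definition closers t n (D : wiring t n) (k : nat) : bool := (arc_nat D k < k)%N.

Lemma arc_natE t n (D : wiring t n) (k : 'I_n) : arc_nat D k = arc_map D k.
Proof. by rewrite /arc_nat valK. Qed.

Lemma set_wordE n (s : {set 'I_n}) (k : 'I_n) : set_word s k = (k \in s).
Proof.
apply/existsP/idP => [[i /andP[si /eqP/val_inj<-]] //|ks].
by exists k; rewrite ks eqxx.
Qed.

Section DiagramWord.
Variables (t n : nat) (D : wiring t n).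
Hypothesis tlD : is_tl_diagram D.

Lemma arc_nat_link : nat_link n (arc_nat D).
Proof.
have L := arc_link tlD.
split.
- by move=> k kn; rewrite (arc_natE _ (Ordinal kn)).
- move=> k kn; rewrite -[k]/(val (Ordinal kn)) !arc_natE.
  by rewrite arc_mapK.
- move=> k u kn un; rewrite -[k]/(val (Ordinal kn)) -[u]/(val (Ordinal un)).
  rewrite !arc_natE !val_eqE; apply: link_noncross L _ _ _ _; rewrite ?inE //.
move=> k u kn un; rewrite -[k]/(val (Ordinal kn)) -[u]/(val (Ordinal un)).
by rewrite !arc_natE val_eqE => /val_inj; apply: link_exposed L _ _ _ _; rewrite ?inE.
Qed.

Variable p : 'I_t -> 'I_n.
Hypothesis ep : forall i : 'I_t, D (inl i) = inr (p i).

(** Both sides enumerate the tops of the through strings in increasing order. *)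
Lemma fixed_points_through :
  [seq k <- iota 0 n | arc_nat D k == k] = [seq val (p i) | i <- enum 'I_t].
Proof.
have E := arc_defects tlD ep.
apply: (@irr_sorted_eq _ ltn); [exact: ltn_trans | exact: ltnn | | |].
- exact/sorted_filter/iota_ltn_sorted/ltn_trans.
- apply: (@homo_sorted _ _ (fun i => val (p i)) (fun i j : 'I_t => (i < j)%N)).
    by move=> i j; apply: defect_mono E _ _.
  by have := iota_ltn_sorted 0 t; rewrite -val_enum_ord sorted_map.
move=> k; rewrite mem_filter mem_iota /= add0n; apply/andP/mapP.
  move=> [/eqP fk kn]; have [i ei] : exists i, Ordinal kn = p i.
    apply: (defect_onto E); rewrite ?inE //; apply: val_inj.
    by rewrite /= -arc_natE.
  by exists i; rewrite ?mem_enum // -ei.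
move=> [i _ ->]; rewrite /= arc_natE (defect_fix E) eqxx.
by split=> //; apply: ltn_ord.
Qed.

Lemma closers_stack : open_stack (closers D) n
  = rev [seq val (p i) | i <- enum 'I_t].
Proof. by rewrite (final_stackE arc_nat_link) // fixed_points_through. Qed.

Lemma closers_well_formed : well_formed (closers D) n.
Proof. exact: (scan_well_formed arc_nat_link). Qed.

Lemma closers_stack_size : size (open_stack (closers D) n) = t.
Proof. by rewrite closers_stack size_rev size_map size_enum_ord. Qed.

Lemma head_closers (k : 'I_n) : closers D k ->
  head 0%N (open_stack (closers D) k) = arc_map D k.
Proof.
by move=> ck; rewrite (head_open_stack arc_nat_link) // arc_natE.
Qed.

(** Stack formula and vertex formula have the same factors: the points left on
    the stack are the fixed points, and the point on top of the stack is the
    partner of the closing point. *)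
Lemma diagram_state (F : fieldType) (a : F) (s : {set 'I_n}) :
  (all_up F t *m tensor_mx a (closers D) n t) ord0 (label_index n (set_word s))
   = state_weight a [set: 'I_n] (arc_map D) s.
Proof.
rewrite state_vector_entry closers_well_formed closers_stack_size eqxx /=.
have -> : closer_weight a (closers D) (set_word s) n =
   \prod_(k : 'I_n) if (arc_map D k < k)%N
      then cup_weight a (arc_map D k \in s) (k \in s) else 1.
  rewrite /closer_weight big_mkcond; apply: eq_bigr => k _.
  rewrite /closers arc_natE; case: ifP => // lk.
  by rewrite head_closers ?/closers ?arc_natE // !set_wordE.
have -> : (all (fun k => ~~ set_word s k) (open_stack (closers D) n))%:R =
   \prod_(k : 'I_n) (if arc_map D k == k then (k \notin s)%:R else 1) :> F.
  case: allP => [al|nal].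
    rewrite big1 // => k _; case: eqP => // fk.
    have := al k; rewrite set_wordE => -> //.
    rewrite (final_stackE arc_nat_link) // mem_rev mem_filter mem_iota /=.
    by rewrite arc_natE fk eqxx ltn_ord.
  have /allPn[z] : ~~ all (fun k => ~~ set_word s k) (open_stack (closers D) n).
    by apply/allP.
  rewrite closers_stack mem_rev => /mapP[i _ ->].
  rewrite set_wordE negbK => ps; rewrite (bigD1 (p i)) //=.
  by rewrite (defect_fix (arc_defects tlD ep)) eqxx ps mul0r.
rewrite -big_split /=; apply: eq_big => [k|k _]; first by rewrite inE.
rewrite /site_weight; have [->|_] := eqVneq (arc_map D k) k; last by rewrite mul1r.
by rewrite ltnn mulr1.
Qed.
End DiagramWord.

Lemma label_index_inj n (s s' : nat -> bool) :
  label_index n s = label_index n s' -> forall k, (k < n)%N -> s k = s' k.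
Proof.
elim: n => //= n IH e k.
have [es eI] : s n = s' n /\ label_index n s = label_index n s'.
  move: e; case: (s n); case: (s' n) => /eqP.
  - by rewrite eq_rshift => /eqP.
  - by rewrite eq_rlshift.
  - by rewrite eq_lrshift.
  - by rewrite eq_lshift => /eqP.
by rewrite ltnS leq_eqVlt => /predU1P[->//|]; apply: IH.
Qed.

Lemma spin_dimE n : d n = (2 ^ n)%N.
Proof. by elim: n => //= n ->; rewrite addnn -mul2n expnS. Qed.

Lemma label_index_bij n : bijective (fun s : {set 'I_n} => label_index n (set_word s)).
Proof.
apply: inj_card_bij => [s s' e|].
  by apply/setP => k; rewrite -!set_wordE; apply: label_index_inj e _ _.
by rewrite card_ord spin_dimE -cardsT -powersetT card_powerset cardsT card_ord.
Qed.

Lemma pairing_dot (F : fieldType) (a q : F) t n (D1 D2 : wiring t n) :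
  a != 0 -> loop_value q = loop_weight a ->
  is_tl_diagram D1 -> Defs.monic D1 -> is_tl_diagram D2 -> Defs.monic D2 ->
  pairing q D1 D2 =
  ((all_up F t *m tensor_mx a (closers D1) n t)
     *m (all_up F t *m tensor_mx a (closers D2) n t)^T) ord0 ord0.
Proof.
move=> a0 lE tl1 mon1 tl2 mon2.
have [p1 ep1] := through_mapE mon1. have [p2 ep2] := through_mapE mon2.
rewrite (pairing_state_sum a0 lE tl1 tl2 ep1 ep2) mxE.
rewrite (reindex _ (onW_bij _ (label_index_bij n))) /=.
apply: eq_bigr => s _.
by rewrite [(_^T) _ _]mxE (diagram_state tl1 ep1) (diagram_state tl2 ep2).
Qed.

(** * Diagrams are determined and realised by their words *)

Lemma open_stack_ext g g' n : (forall k, (k < n)%N -> g k = g' k) ->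
  open_stack g n = open_stack g' n.
Proof.
elim: n => //= n IH e; rewrite e // IH // => k kn.
by apply: e; rewrite ltnW.
Qed.

(** Equal words have equal stacks; these determine the partners of the right ends
    of cups, and hence everything. *)
Lemma closers_inj t n (D D' : wiring t n) :
  is_tl_diagram D -> Defs.monic D -> is_tl_diagram D' -> Defs.monic D' ->
  (forall k, (k < n)%N -> closers D k = closers D' k) -> D = D'.
Proof.
move=> tl mon tl' mon' e.
have [p ep] := through_mapE mon. have [p' ep'] := through_mapE mon'.
have eS k : (k <= n)%N -> open_stack (closers D) k = open_stack (closers D') k.
  by move=> kn; apply: open_stack_ext => l lk; apply: e; apply: leq_trans lk kn.
have epp : p =1 p'.
  move=> i; have := eS n (leqnn n).
  rewrite (closers_stack tl ep) (closers_stack tl' ep') => /(can_inj (@revK _))/eq_in_map/(_ i).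
  by rewrite mem_enum => /(_ isT)/val_inj.
have ecl (k : 'I_n) : closers D k -> arc_map D k = arc_map D' k.
  move=> ck; apply: val_inj; rewrite /= -(head_closers tl ck).
  by rewrite eS ?(ltnW (ltn_ord k)) // head_closers // -e.
have eal k : arc_map D k = arc_map D' k.
  have [lt|lt|eq] := ltngtP (arc_map D k) k.
  - by apply: ecl; rewrite /closers arc_natE.
  - have := ecl (arc_map D k); rewrite /closers arc_natE arc_mapK // => /(_ lt).
    by move=> ek; rewrite [in RHS]ek arc_mapK.
  have fk : arc_map D k = k by apply: val_inj.
  have [i ei] := defect_onto (arc_defects tl ep) (in_setT k) fk.
  by rewrite fk ei epp (defect_fix (arc_defects tl' ep')).
apply/ffunP => -[i|k]; first by rewrite ep ep' epp.
have [[i ei _]|[ek nk]] := arc_mapP tl k.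
  have := wiringK tl (inr k); rewrite ei ep epp => -[<-].
  by rewrite -ep' wiringK.
have [[i _]|[-> _]] := arc_mapP tl' k; last by rewrite ek eal.
by rewrite -eal => e'; rewrite e' eqxx in nk.
Qed.

(** By induction on the word.  A closing letter joins the new point to the last
    fixed point z, and the other arcs stay clear of the new one because z was not
    enclosed by them. *)
Lemma realize_link g n : well_formed g n ->
  exists A, nat_link n A /\ forall k, (k < n)%N -> g k = (A k < k)%N.
Proof.
elim: n => [_|n IH /= /andP[wf]]; first by exists id.
have [A [L gA]] := IH wf.
have An k : (k < n)%N -> A k != n by move=> /(nat_link_lt L) lt; rewrite ltn_eqF.
have [cl /=|op _] := boolP (g n); last first.
  exists (fun k => if k == n then n else A k).
  have An' k : (k < n)%N -> (A k == n) = false by move=> /An/negPf.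
  have split_lt k : (k < n.+1)%N -> k = n \/ (k < n)%N.
    by rewrite ltnS leq_eqVlt => /predU1P.
  split; last first.
    move=> k /split_lt[->|kn]; first by rewrite eqxx ltnn (negPf op).
    by rewrite (ltn_eqF kn) gA.
  split.
  - move=> k /split_lt[->|kn]; first by rewrite eqxx.
    by rewrite (ltn_eqF kn) ltnW // ltnS (nat_link_lt L).
  - move=> k /split_lt[->|kn]; first by rewrite !eqxx.
    by rewrite (ltn_eqF kn) An' ?(nat_linkK L).
  - move=> k u /split_lt[->|kn]; first by rewrite /= eqxx => *; rewrite !separates_refl.
    move=> /split_lt[->|un]; first by rewrite eqxx.
    by rewrite (ltn_eqF kn) (ltn_eqF un); apply: (nat_link_noncross L).
  - move=> k u /split_lt[->|kn]; first by rewrite /= eqxx => *; rewrite separates_refl.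
    move=> /split_lt[->|un].
      have := nat_link_lt L kn; rewrite (ltn_eqF kn) /separates => lt _ _.
      by rewrite kn lt.
    by rewrite (ltn_eqF kn) (ltn_eqF un); apply: (nat_link_exposed L).
have stE := final_stackE L gA.
case est: (open_stack g n) => [//|z st] _.
have efx : [seq k <- iota 0 n | A k == k] = rcons (rev st) z.
  by rewrite -[LHS]revK -stE est rev_cons.
have inz k : (k < n)%N -> (A k == k) = (k \in rcons (rev st) z).
  by move=> kn; rewrite -efx mem_filter mem_iota add0n /= kn andbT.
have [/eqP Az zn] : (A z == z) /\ (z < n)%N.
  have : z \in rcons (rev st) z by rewrite mem_rcons inE eqxx.
  by rewrite -efx mem_filter mem_iota add0n /= => /andP[-> ->].
(* The top of the stack is the last fixed point. *)
have zmax k : (k < n)%N -> A k = k -> k != z -> (k < z)%N.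
  move=> kn /eqP; rewrite inz // mem_rcons inE => /predU1P[->|ks _].
    by rewrite eqxx.
  have : sorted ltn (rcons (rev st) z).
    rewrite -efx; exact/sorted_filter/iota_ltn_sorted/ltn_trans.
  rewrite -cats1 sorted_pairwise; last exact: ltn_trans.
  rewrite pairwise_cat => /andP[/allrelP h _].
  by apply: h; rewrite ?inE.
have zNn : z != n by rewrite ltn_eqF.
exists (fun k => if k == z then n else if k == n then z else A k).
have split_lt k : (k < n.+1)%N -> [\/ k = n, k = z | (k < n)%N /\ k != z].
  rewrite ltnS leq_eqVlt => /predU1P[->|kn]; first by constructor 1.
  by have [->|kz] := eqVneq k z; [constructor 2 | constructor 3].
have Anz k : (k < n)%N -> k != z -> (A k == z) = false /\ (A k == n) = false.
  move=> kn kz; rewrite (negPf (An k kn)); split=> //.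
  by apply/negP => /eqP e; rewrite -(nat_linkK L kn) e Az eqxx in kz.
have nz : (n == z) = false by rewrite eq_sym (negPf zNn).
(* No arc separates n from z, and the new arc separates no pair of partners. *)
have sep_zn k : (k < n)%N -> k != z -> separates n z (A k) = separates n z k.
  move=> kn kz; have An' := nat_link_lt L kn.
  have zk : z != k by rewrite eq_sym.
  have := nat_link_exposed L kn zn Az zk; have [+ _] := Anz k kn kz.
  by move: kn An' zn kz; rewrite /separates; clear; lia.
have sep_k k : (k < n)%N -> k != z -> ~~ separates k (A k) n /\ ~~ separates k (A k) z.
  move=> kn kz; have An' := nat_link_lt L kn.
  split; first by rewrite /separates kn An'.
  by apply: (nat_link_exposed L) => //; rewrite eq_sym.
split; last first.
  move=> k /split_lt[->|->|[kn kz]].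
  - by rewrite nz eqxx zn cl.
  - by rewrite eqxx gA // Az ltnn ltnNge (ltnW zn).
  by rewrite (negPf kz) (ltn_eqF kn) gA.
split.
- move=> k /split_lt[->|->|[kn kz]].
  + by rewrite nz eqxx ltnW.
  + by rewrite eqxx.
  by rewrite (negPf kz) (ltn_eqF kn) ltnW // ltnS (nat_link_lt L).
- move=> k /split_lt[->|->|[kn kz]].
  + by rewrite nz !eqxx.
  + by rewrite eqxx nz eqxx.
  have [e1 e2] := Anz k kn kz.
  by rewrite (negPf kz) (ltn_eqF kn) e1 e2 (nat_linkK L).
- move=> k u /split_lt[->|->|[kn kz]] /split_lt[->|->|[un uz]];
    rewrite ?eqxx ?nz ?(negPf zNn) ?(negPf kz) ?(ltn_eqF kn) ?(negPf uz) ?(ltn_eqF un) //.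
  + by rewrite eqxx.
  + by move=> _ _; apply: sep_zn.
  + by move=> _ _; rewrite ![separates z n _]separatesC; apply: sep_zn.
  + by have [/negPf-> /negPf->] := sep_k k kn kz.
  + by have [/negPf-> /negPf->] := sep_k k kn kz.
  by apply: (nat_link_noncross L).
move=> k u /split_lt[->|->|[kn kz]] /split_lt[->|->|[un uz]];
  rewrite ?eqxx ?nz ?(negPf zNn) ?(negPf kz) ?(ltn_eqF kn) ?(negPf uz) ?(ltn_eqF un) //.
- by move=> e; rewrite e eqxx in zNn.
- move=> Au _; have := zmax u un Au uz; rewrite /separates => uz'.
  by rewrite !ltnNge (ltnW un) (ltnW uz').
- by move=> e; rewrite e eqxx in zNn.
- move=> Au _; have := zmax u un Au uz; rewrite /separates => uz'.
  by rewrite !ltnNge (ltnW un) (ltnW uz').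
- by move=> _ _; case: (sep_k k kn kz).
- by move=> _ _; case: (sep_k k kn kz).
by apply: (nat_link_exposed L).
Qed.

(** The through strings are attached to the fixed points of the link state in
    increasing order. *)
Lemma realize_diagram g n t : well_formed g n -> size (open_stack g n) = t ->
  exists D : wiring t n, [/\ is_tl_diagram D, Defs.monic D &
    forall k, (k < n)%N -> closers D k = g k].
Proof.
move=> wf sz; have [A [L gA]] := realize_link wf.
pose fx := [seq k <- iota 0 n | A k == k].
have szf : size fx = t by rewrite -sz (final_stackE L gA) size_rev.
have memf k : (k \in fx) = (k < n)%N && (A k == k).
  by rewrite mem_filter mem_iota add0n andbC.
have uf : uniq fx by rewrite filter_uniq // iota_uniq.
have sf : sorted ltn fx by exact/sorted_filter/iota_ltn_sorted/ltn_trans.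
have nthf (i : 'I_t) : nth 0%N fx i \in fx by rewrite mem_nth // szf.
have ltf (i : 'I_t) : (nth 0%N fx i < n)%N by have := nthf i; rewrite memf => /andP[].
have monof (i j : 'I_t) : (i < j)%N -> (nth 0%N fx i < nth 0%N fx j)%N.
  move=> ij; apply: (sorted_ltn_nth ltn_trans 0%N sf) => //; by rewrite inE szf.
pose p i : 'I_n := Ordinal (ltf i).
pose al (k : 'I_n) : 'I_n := Ordinal (nat_link_lt L (ltn_ord k)).
pose D : wiring t n := [ffun x : point t n => match x with
  | inl i => inr (p i)
  | inr k => if insub (index (k : nat) fx) is Some i then inl i else inr (al k)
  end].
have Dl i : D (inl i) = inr (p i) by rewrite ffunE.
have Dp i : D (inr (p i)) = inl i.
  by rewrite ffunE /= index_uniq ?szf // valK.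
have Da (k : 'I_n) : A k != k -> D (inr k) = inr (al k).
  move=> nk; rewrite ffunE insubF // -szf index_mem memf (negPf nk).
  by rewrite andbF.
have fixP (k : 'I_n) : A k = k -> exists i, k = p i.
  move=> /eqP fk; have kf : (k : nat) \in fx by rewrite memf ltn_ord fk.
  have it : (index (k : nat) fx < t)%N by rewrite -szf index_mem.
  by exists (Ordinal it); apply: val_inj; rewrite /= nth_index.
have Afix i : A (p i) = p i by apply/eqP; have := nthf i; rewrite memf => /andP[].
have alK (k : 'I_n) : A (al k) = k by rewrite /= (nat_linkK L).
have arcE (k : 'I_n) : arc_map D k = al k.
  have [fk|nk] := eqVneq (A k) k; last by rewrite /arc_map Da.
  have [i ei] := fixP k fk; rewrite /arc_map ei Dp; apply: val_inj => /=.
  by rewrite -[LHS](Afix i).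
have clD k : (k < n)%N -> closers D k = g k.
  by move=> kn; rewrite /closers (arc_natE D (Ordinal kn)) arcE gA.
have case_top (k : 'I_n) : (exists i, k = p i) \/
    [/\ A k != k, A (al k) != al k & D (inr k) = inr (al k)].
  have [/fixP|nk] := eqVneq (A k) k; first by left.
  by right; rewrite (nat_linkK L) // eq_sym nk Da.
exists D; split=> //; last by apply/forallP => i; rewrite Dl.
apply/andP; split.
  apply/forallP => -[i|k]; first by rewrite Dl Dp eqxx.
  have [[i ->]|[nk nk' ->]] := case_top k; first by rewrite Dp Dl eqxx.
  rewrite Da // (_ : al (al k) = k) ?eqxx ?andbT; last by apply/val_inj/alK.
  by apply: contra_neq nk => -[e]; apply/eqP; rewrite -{2}e.
apply/forallP => x; apply/forallP => y; apply/negP => /and3P[].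
have topp (k : 'I_n) : boundary_pos (inr k : point t n) = (t + (n - k.+1))%N by [].
have boti (i : 'I_t) : boundary_pos (inl i : point t n) = i by [].
have lt_top (k l : 'I_n) : (boundary_pos (inr k : point t n) <
    boundary_pos (inr l : point t n))%N = (l < k)%N.
  by rewrite !topp; have := ltn_ord k; have := ltn_ord l; clear; lia.
have lt_top_bot (k : 'I_n) (i : 'I_t) : (boundary_pos (inr k : point t n) <
    boundary_pos (inl i : point t n))%N = false.
  by rewrite topp boti; have := ltn_ord i; clear; lia.
case: x => [i|k]; case: y => [j|u].
- rewrite !Dl lt_top => ij _ /(ltn_trans (monof _ _ ij)); rewrite ltnn //.
- have [[j ->]|[nu nu' eu]] := case_top u; first by rewrite Dp !Dl lt_top_bot.
  rewrite Dl eu !lt_top => _ lt1 lt2.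
  have := nat_link_exposed L (ltn_ord u) (ltn_ord (p i)) (Afix i) _.
  rewrite (ltn_eqF lt1) => /(_ isT).
  by rewrite /separates -[A u]/(val (al u)) lt2 ltnNge (ltnW lt1).
- by rewrite lt_top_bot.
have [[i ->]|[nk nk' ek]] := case_top k; first by rewrite Dp lt_top_bot.
have [[i ->]|[nu nu' eu]] := case_top u; first by rewrite Dp ek !lt_top_bot.
rewrite ek eu !lt_top => lt1 lt2 lt3.
have := nat_link_noncross L (ltn_ord k) (ltn_ord u) _ _.
rewrite (ltn_eqF lt1) -[A k]/(val (al k)) (gtn_eqF lt2) => /(_ isT isT).
have nlt (v w : nat) : (v < w)%N -> (w < v)%N = false by move=> /ltnW; rewrite ltnNge => ->.
rewrite /separates -[A u]/(val (al u)) lt2 (nlt _ _ lt1) (nlt _ _ lt3).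
by rewrite (nlt _ _ (ltn_trans lt3 (ltn_trans lt2 lt1))).
Qed.

(** * Dimensions of simple modules as Gram ranks *)

Section FormRank.
Variables (F : fieldType) (I : finType).
Let V : vectType F := {ffun I -> F^o}.

Definition coordinates (u : V) : 'rV[F]_#|I| := \row_i (u (enum_val i) : F).
Definition from_coordinates (r : 'rV[F]_#|I|) : V :=
  [ffun i => (r ord0 (enum_rank i) : F^o)].

Fact coordinates_linear : linear coordinates.
Proof. by move=> c u v; apply/rowP => i; rewrite !mxE !ffunE. Qed.
HB.instance Definition _ :=
  GRing.isLinear.Build F V 'rV[F]_#|I| _ coordinates coordinates_linear.

Fact from_coordinates_linear : linear from_coordinates.
Proof. by move=> c u v; apply/ffunP => i; rewrite !ffunE !mxE. Qed.
HB.instance Definition _ :=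
  GRing.isLinear.Build F 'rV[F]_#|I| V _ from_coordinates from_coordinates_linear.

Lemma coordinatesK : cancel coordinates from_coordinates.
Proof. by move=> u; apply/ffunP => i; rewrite ffunE mxE enum_rankK. Qed.

Lemma from_coordinatesK : cancel from_coordinates coordinates.
Proof. by move=> r; apply/rowP => i; rewrite mxE ffunE enum_valK. Qed.

Lemma dim_ffun : \dim {: V} = #|I|.
Proof. by rewrite dimvf /dim /= muln1. Qed.

(** The kernel of a linear map is defined through an unspecified basis; P and Q
    below are the changes of coordinates between it and the standard one. *)
Lemma dim_quotient_lker (phi : {linear V -> V}) (G : 'M[F]_#|I|) :
  (forall u, coordinates (phi u) = coordinates u *m G) ->
  (\dim {: V} - \dim (lker (linfun phi)))%N = \rank G.
Proof.
move=> phiE.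
pose P := lin1_mx (coordinates \o r2v); pose Q := lin1_mx (v2r \o from_coordinates).
have PQ : P *m Q = 1%:M.
  apply/row_matrixP => i; rewrite !rowE mulmxA !mul_rV_lin1 mulmx1 /=.
  by rewrite coordinatesK r2vK.
have QP : Q *m P = 1%:M.
  apply/row_matrixP => i; rewrite !rowE mulmxA !mul_rV_lin1 mulmx1 /=.
  by rewrite v2rK from_coordinatesK.
have M : f2mx (linfun phi) = P *m G *m Q.
  rewrite unlock /=; apply/row_matrixP => i; rewrite !rowE !mulmxA !mul_rV_lin1 /=.
  by rewrite -phiE coordinatesK.
have -> : \dim (lker (linfun phi)) = (dim V - \rank (P *m G *m Q))%N.
  by rewrite /dimv /= mxrank_gen mxrank_ker M.
rewrite dimvf.
have rk : \rank (P *m G *m Q) = \rank G.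
  apply/eqP; rewrite eqn_leq; apply/andP; split.
    by rewrite (leq_trans (mxrankM_maxl _ _)) ?mxrankM_maxr.
  have {1}-> : G = Q *m (P *m G *m Q) *m P.
    by rewrite !mulmxA QP mul1mx -mulmxA QP mulmx1.
  by rewrite (leq_trans (mxrankM_maxl _ _)) ?mxrankM_maxr.
by rewrite subKn ?rk // -rk rank_leq_row.
Qed.
End FormRank.

Section SimpleDim.
Variables (F : fieldType) (a q : F).
Hypotheses (a_neq0 : a != 0) (loopE : loop_value q = loop_weight a).

Lemma open_stack_admissible g n : well_formed g n ->
  admissible n (size (open_stack g n)).
Proof.
elim: n => //= n IH /andP[/IH/andP[szn /eqP par]].
rewrite /admissible; case: (g n) => /=; last by rewrite par ltnS szn eqxx.
case: (open_stack g n) szn par => //= z st szn <- _.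
by rewrite negbK eqxx (leq_trans (leqnSn _)) // leqW.
Qed.

Lemma state_vector_neq0 g n t : all_up F t *m tensor_mx a g n t != 0 ->
  well_formed g n && (size (open_stack g n) == t).
Proof.
apply: contraR => /negPf bad; apply/eqP/rowP => j.
have [lab _ labK] := label_index_bij n.
by rewrite -[j]labK state_vector_entry bad mxE.
Qed.

Definition diagram_row t n (D : wiring t n) : 'rV[F]_(d n) :=
  all_up F t *m tensor_mx a (closers D) n t.

Definition diagram_mx t n : 'M[F]_(#|monic_diagram t n|, d n) :=
  \matrix_i diagram_row (val (enum_val i)).

(** Nonzero state vectors of words are state vectors of diagrams. *)
Lemma diagram_mx_span t n : (diagram_mx t n :=: cell_span a t n)%MS.
Proof.
apply/eqmxP/andP; split.
  by apply/row_subP => i; rewrite rowK; apply: mem_cell_span.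
apply: cell_span_min => g.
have [->|/state_vector_neq0/andP[wf /eqP sz]] := eqVneq (all_up F t *m tensor_mx a g n t) 0.
  exact: sub0mx.
have [D [tl mon eg]] := realize_diagram wf sz.
rewrite -(tensor_ext a _ eg).
have mD : is_tl_diagram D && Defs.monic D by rewrite tl mon.
have -> : all_up F t *m tensor_mx a (closers D) n t =
    row (enum_rank (Sub D mD : monic_diagram t n)) (diagram_mx t n).
  by rewrite rowK enum_rankK SubK.
exact: row_sub.
Qed.

(** The matrix of the form in the basis of diagrams is the Gram matrix of the
    state vectors, by [pairing_dot]. *)
Lemma simple_dimE t n : simple_dim q t n = gram_rank a t n.
Proof.
rewrite /simple_dim; case: ifP => adm; last first.
  suff -> : gram_rank a t n = 0%N by [].
  suff h0 : cell_span a t n = 0 by rewrite /gram_rank h0 mul0mx mxrank0.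
  apply/eqP; rewrite -submx0; apply: cell_span_min => g; rewrite submx0.
  apply: contraFT adm => /state_vector_neq0/andP[wf /eqP <-].
  exact: open_stack_admissible.
rewrite /gram_rank -(rank_gram_eqmx (diagram_mx_span t n)).
apply: dim_quotient_lker => u; apply/rowP => j; rewrite mxE ffunE.
rewrite /cell_form mxE (reindex _ (onW_bij _ (@enum_val_bij (monic_diagram t n)))).
apply: eq_bigr => i _; rewrite (bigD1 (enum_val j)) //= big1 ?addr0; last first.
  by move=> D /negPf nD; rewrite ffunE nD mulr0 mul0r.
rewrite ffunE eqxx mulr1 mxE; congr (_ * _).
have [/andP[tli moni] /andP[tlj monj]] := (valP (enum_val i), valP (enum_val j)).
rewrite (pairing_dot a_neq0) // !mxE; apply: eq_bigr => k _.
by rewrite ![(_^T) _ _]mxE ![diagram_mx _ _ _ _]mxE.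
Qed.

Lemma cell_dimE t n : cell_dim F t n =
  if admissible n t then #|monic_diagram t n| else 0%N.
Proof. by rewrite /cell_dim; case: ifP => // _; rewrite dim_ffun. Qed.
End SimpleDim.

(** * The recursion at a root of unity *)

(** Through strings end at different top points. *)
Lemma monic_diagram_le t n : (n < t)%N -> #|monic_diagram t n| = 0%N.
Proof.
move=> nt; apply/eqP; rewrite -leqn0 leqNgt; apply/negP => /card_gt0P[D _].
have /andP[tl mon] := valP D.
have [p ep] := through_mapE mon.
have pinj : injective p.
  move=> i j e; have := wiringK tl (inl i); rewrite ep e -ep wiringK // => -[].
  by [].
by have := leq_card p pinj; rewrite !card_ord leqNgt nt.
Qed.

Definition previous_diagram t n : finType :=
  if t is t'.+1 then monic_diagram t' n else void.

Definition previous_closers t n : previous_diagram t n -> nat -> bool :=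
  if t is t'.+1 return previous_diagram t n -> nat -> bool
  then fun D => closers (val D) else fun _ _ => false.

Definition smaller_closers t n (x : previous_diagram t n + monic_diagram t.+1 n) :
    nat -> bool :=
  match x with inl D => previous_closers D | inr D => closers (val D) end.

(** Removing the last top point from a diagram t -> n+1 either removes a through
    string or opens a cup; the word of the diagram can be recovered. *)
Lemma monic_diagram_step t n :
  (#|monic_diagram t n.+1| <=
    (if t is t'.+1 then #|monic_diagram t' n| else 0)
      + #|monic_diagram t.+1 n|)%N.
Proof.
have ex (D : monic_diagram t n.+1) : exists x : previous_diagram t n + monic_diagram t.+1 n,
    closers (val D) n = (if x is inr _ then true else false) /\
    forall k, (k < n)%N -> smaller_closers x k = closers (val D) k.
  have /andP[tl mon] := valP D.
  have [p ep] := through_mapE mon.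
  have /= := closers_stack_size tl ep; have /= := closers_well_formed tl.
  move=> /andP[wf]; case cl: (closers (val D) n) => /= ne sz.
    have sz' : size (open_stack (closers (val D)) n) = t.+1.
      by case: (open_stack _ n) ne sz => //= z st _ ->.
    have [E [tlE monE eE]] := realize_diagram wf sz'.
    have mE : is_tl_diagram E && Defs.monic E by rewrite tlE monE.
    by exists (inr (Sub E mE : monic_diagram t.+1 n)); split=> // k kn; rewrite -eE.
  case: t D tl mon p ep wf cl ne sz => // t D tl mon p ep wf cl ne [sz].
  have [E [tlE monE eE]] := realize_diagram wf sz.
  have mE : is_tl_diagram E && Defs.monic E by rewrite tlE monE.
  by exists (inl (Sub E mE : previous_diagram t.+1 n)); split=> // k kn; rewrite -eE.
have [f fE] := fin_all_exists ex.
have finj : injective f.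
  move=> D D' e; have [cn ck] := fE D; have [cn' ck'] := fE D'.
  have /andP[tl mon] := valP D. have /andP[tl' mon'] := valP D'.
  apply/val_inj/closers_inj => // k; rewrite ltnS leq_eqVlt => /predU1P[->|kn].
    by rewrite cn cn' e.
  by rewrite -ck // -ck' // e.
apply: leq_trans (leq_card f finj) _; rewrite card_sum leq_add2r.
by case: (t) => [|t']; rewrite ?card_void.
Qed.

Lemma card_monic_diagram0 t : (#|monic_diagram t 0| <= (t == 0%N))%N.
Proof.
case: t => [|t]; last by rewrite monic_diagram_le.
apply/card_le1P => D _ D'; rewrite !inE; apply/esym/eqP/val_inj.
have /andP[tl mon] := valP D. have /andP[tl' mon'] := valP D'.
exact: closers_inj.
Qed.

Section RootOfUnity.
Variables (F : fieldType) (ell : nat) (a q : F).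
Hypotheses (ell_ge4 : (4 <= ell)%N) (a_neq0 : a != 0) (q_neq0 : q != 0).
Hypotheses (aaq : a * a * q = -1) (ord_q2 : ell.-primitive_root (q ^+ 2)).

Let loopE : loop_value q = loop_weight a.
Proof.
have a2 : a ^+ 2 = - q^-1.
  by apply: (mulIf q_neq0); rewrite mulNr mulVf // expr2.
by rewrite /loop_value /loop_weight exprVn a2 invrN invrK opprD addrC.
Qed.

Let q2_neq1 : q ^+ 2 != 1.
Proof.
by rewrite -[_ ^+ 2]expr1 -(prim_order_dvd ord_q2) dvdn1 gtn_eqF // (leq_trans _ ell_ge4).
Qed.

Lemma qnum_eq0 k : (qnum q k == 0) = (ell %| k)%N.
Proof.
rewrite /qnum mulf_eq0 invr_eq0 subr_eq0 subr_eq0 (negPf q2_neq1) orbF.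
by rewrite -mul2n exprM (prim_order_dvd ord_q2).
Qed.

Local Notation L := (simple_dim q).

(** For 0 < k <= ell the quantum integer [k] vanishes only at k = ell. *)
Lemma simple_dim_step s n : (s <= ell - 2)%N ->
  L s n.+1 = ((if s is s'.+1 then L s' n else 0)
               + (s.+2 != ell) * L s.+1 n)%N.
Proof.
move=> sl; have lt_dvd k : (0 < k)%N -> (k <= ell)%N -> (ell %| k)%N = (k == ell).
  move=> k0 kl; apply/idP/eqP => [/(dvdn_leq k0) lk|-> //].
  by apply/eqP; rewrite eqn_leq kl.
rewrite (simple_dimE a_neq0 loopE) (gram_rank_rec a_neq0 q_neq0 aaq) //; last first.
  by rewrite qnum_eq0 lt_dvd //; move: ell_ge4 sl; clear; lia.
rewrite qnum_eq0 lt_dvd //; last by move: ell_ge4 sl; clear; lia.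
by rewrite (simple_dimE a_neq0 loopE); case: s {sl} => // s; rewrite (simple_dimE a_neq0 loopE).
Qed.

Lemma simple_dim0 t : L t 0 = (t == 0%N).
Proof. by rewrite (simple_dimE a_neq0 loopE) gram_rank0. Qed.

Lemma simple_dim_le t n : (L t n <= #|monic_diagram t n|)%N.
Proof.
by rewrite /simple_dim; case: ifP => // _; rewrite dim_ffun leq_subr.
Qed.

(** The form is non-degenerate by induction on n: the recursion for the ranks loses
    a summand only if t + 2 = ell, and that summand counts diagrams ell-1 -> n with
    n < ell-1. *)
Lemma simple_dim_full n t : (n <= ell - 1)%N -> (t <= ell - 2)%N ->
  L t n = #|monic_diagram t n|.
Proof.
move=> nl tl; apply/eqP; rewrite eqn_leq simple_dim_le /=.
elim: n t nl tl => [|n IH] t nl tl.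
  by rewrite simple_dim0 card_monic_diagram0.
apply: leq_trans (monic_diagram_step t n) _; rewrite simple_dim_step //.
apply: leq_add.
  by case: t tl => // t tl; apply: IH; move: nl tl; clear; lia.
have [tell|tell] := eqVneq t.+2 ell.
  by rewrite monic_diagram_le //; move: tell nl; clear; lia.
by rewrite mul1n; apply: IH; move: nl tl tell ell_ge4; clear; lia.
Qed.

(** The coefficient of [simple_dim q s n] counts the neighbours of s on the path
    0 - 1 - ... - (ell-2), which are the ways of stepping away and back. *)
Lemma simple_dim_step2 s n : (s <= ell - 2)%N ->
  L s n.+2 = ((if s is s'.+2 then L s' n else 0)
    + ((s != 0%N) + (s.+2 != ell)) * L s n
    + ((s.+2 != ell) && (s.+3 != ell)) * L s.+2 n)%N.
Proof.
move=> sl; rewrite simple_dim_step //.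
have -> : (if s is s'.+1 then L s' n.+1 else 0)%N =
    ((if s is s'.+2 then L s' n else 0) + (s != 0) * L s n)%N.
  case: s sl => //= s sl; rewrite simple_dim_step; last by rewrite ltnW.
  have -> : (s.+2 != ell) by move: sl ell_ge4; clear; lia.
  by case: s sl.
have [e|ne] := eqVneq s.+2 ell; first by rewrite mul0n !addn0.
rewrite simple_dim_step; last by move: sl ne ell_ge4; clear; lia.
by rewrite mulnDl !mul1n /=; ring.
Qed.

Lemma simple_dim_initial : 
  initial_conditions ell (fun i n => (cell_dim F i n)%:Z) (fun i n => (L i n)%:Z).
Proof.
have init n i : (n <= ell - 1)%N -> (i <= ell - 2)%N -> L i n = cell_dim F i n.
  move=> nl il; rewrite cell_dimE; case: ifP => [_|nadm]; first exact: simple_dim_full.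
  by rewrite /simple_dim nadm.
split=> i il _; congr Posz; apply: init => //.
by move: ell_ge4; clear; lia.
Qed.
End RootOfUnity.

(** * The recurrence matrices *)

Lemma sum_ord_eq m k (f : nat -> int) :
  \sum_(j < m) (if j == k :> nat then f j else 0) = if (k < m)%N then f k else 0.
Proof.
rewrite -big_mkcond; case: ltnP => km.
  by rewrite (big_pred1 (Ordinal km)) // => j; rewrite -val_eqE.
rewrite big_pred0 // => j; apply: ltn_eqF; exact: leq_trans (ltn_ord j) km.
Qed.

Lemma tridiag_mulE (a b : int) m (f : nat -> int) (i : 'I_m) :
  \sum_(j < m) tridiag a b m i j * f j =
    (if i : nat is k.+1 then f k else 0)
    + (if i == 0%N :> nat then a else if i.+1 == m then b else 2) * f i
    + (if i.+1 == m then 0 else f i.+1).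
Proof.
set c := if i == 0%N :> nat then a else _.
transitivity (\sum_(j < m) ((if i : nat is k.+1 then (if j == k :> nat then f j else 0) else 0)
   + (if j == i :> nat then c * f j else 0) + (if j == i.+1 :> nat then f j else 0))).
  apply: eq_bigr => j _; rewrite mxE -!val_eqE /= [i == j :> nat]eq_sym.
  have [->|nij] := eqVneq (j : nat) i.
    rewrite (ltn_eqF (ltnSn i)) addr0 -/c; case: (i : nat) => [|k]; first by rewrite add0r.
    by rewrite (gtn_eqF (ltnSn k)) add0r.
  rewrite addr0 [i.+1 == j]eq_sym; have [->|nij'] := eqVneq (j : nat) i.+1.
    rewrite mul1r; case: (i : nat) => [|k]; first by rewrite add0r.
    by rewrite gtn_eqF ?add0r // ltnW.
  rewrite addr0 /=; case: (i : nat) => [|k]; first by rewrite mul0r.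
  by rewrite eqSS; case: ifP; rewrite ?mul1r ?mul0r.
rewrite !big_split /= (sum_ord_eq _ _ (fun j => c * f j)) sum_ord_eq ltn_ord.
congr (_ + _ + _).
  case ei: (i : nat) => [|k]; first by rewrite big1.
  by rewrite sum_ord_eq ltnW // -ei ltn_ord.
by rewrite ltn_neqAle ltn_ord andbT; case: eqP.
Qed.

(** The form in which [simple_dim_step2] is compared with a tridiagonal matrix;
    the map idx enumerates the even or the odd indices. *)
Lemma recurrence_tridiag (x : nat -> nat -> int) (idx : nat -> nat) (a b : int) m :
  (forall n i, (i < m)%N -> x (idx i) (n + 2)%N =
    (if i is k.+1 then x (idx k) n else 0)
    + (if i == 0%N then a else if i.+1 == m then b else 2) * x (idx i) n
    + (if i.+1 == m then 0 else x (idx i.+1) n)) ->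
  recurrence (fun m n => \col_(i < m) x (idx i) n) (tridiag a b m).
Proof.
move=> h n _; apply/matrixP => i j; rewrite !mxE h //.
rewrite -(tridiag_mulE a b (fun k => x (idx k) n)).
by apply: eq_bigr => k _; rewrite [X in _ = _ * X]mxE.
Qed.

Lemma matrix22E (a b : int) : matrix22 a 1 1 b = tridiag a b 2.
Proof. by apply/matrixP => -[[|[|//]] i] [[|[|//]] j]; rewrite !mxE. Qed.

Section Recurrences.
Variables (F : fieldType) (ell : nat) (a q : F).
Hypotheses (ell_ge4 : (4 <= ell)%N) (a_neq0 : a != 0) (q_neq0 : q != 0).
Hypotheses (aaq : a * a * q = -1) (ord_q2 : ell.-primitive_root (q ^+ 2)).

Let l := fun i n : nat => (simple_dim q i n)%:Z.

Let l2 s n : (s <= ell - 2)%N ->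
  l s n.+2 = (if s is s'.+2 then l s' n else 0)
    + ((s != 0%N) + (s.+2 != ell))%:Z * l s n
    + ((s.+2 != ell) && (s.+3 != ell))%:Z * l s.+2 n.
Proof.
move=> sl; rewrite /l (simple_dim_step2 ell_ge4 a_neq0 q_neq0 aaq ord_q2) //.
by rewrite !PoszD !PoszM; case: s sl => [|[|s]].
Qed.

(** The last even index is ell-2, an end of the path, if ell is even, and ell-3
    otherwise; the index 0 is always an end. *)
Lemma even_recurrence m (b : int) : (1 < m)%N ->
  (m.*2 == ell) && (b == 1) || (m.*2.+1 == ell) && (b == 2) ->
  recurrence (even_vector l) (tridiag 1 b m).
Proof.
move=> m1 hb; apply: (recurrence_tridiag (idx := double)) => n i im.
rewrite addn2 l2; last by move: hb im; clear; lia.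
have e2 : (i.*2.+2 != ell) && (i.*2.+3 != ell) = (i.+1 != m).
  by move: hb im; clear; lia.
have e1 : (i.*2.+2 != ell)%:Z = if i.+1 == m then b - 1 else 1.
  case/orP: hb => /andP[/eqP<- /eqP->].
    by rewrite -doubleS (inj_eq double_inj); case: eqP.
  have -> : (i.*2.+2 == m.*2.+1) = false by clear; lia.
  by case: eqP.
rewrite e2 PoszD e1 doubleS.
case: i im {e1 e2} => [|i] im; rewrite ?doubleS /=.
  by rewrite (ltn_eqF m1) /=; ring.
by case: eqVneq => _ /=; ring.
Qed.

(** The last odd index is an end of the path exactly if ell is odd; the index 1
    never is. *)
Lemma odd_recurrence m (b : int) : (1 < m)%N ->
  (m.*2.+1 == ell) && (b == 1) || (m.*2.+2 == ell) && (b == 2) ->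
  recurrence (odd_vector l) (tridiag 2 b m).
Proof.
move=> m1 hb; apply: (recurrence_tridiag (idx := fun i => i.*2.+1)) => n i im.
rewrite addn2 l2; last by move: hb im; clear; lia.
have e2 : (i.*2.+3 != ell) && (i.*2.+4 != ell) = (i.+1 != m).
  by move: hb im; clear; lia.
have e1 : (i.*2.+3 != ell)%:Z = if i.+1 == m then b - 1 else 1.
  case/orP: hb => /andP[/eqP<- /eqP->].
    by rewrite eqSS -doubleS (inj_eq double_inj); case: eqP.
  have -> : (i.*2.+3 == m.*2.+2) = false by clear; lia.
  by case: eqP.
rewrite e2 PoszD e1 doubleS.
case: i im {e1 e2} => [|i] im; rewrite ?doubleS /=.
  by rewrite (ltn_eqF m1) /=; ring.
by case: eqVneq => _ /=; ring.
Qed.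

Lemma recurrences_simple_dim : recurrences ell l.
Proof.
split.
- move=> ge6 ev; split.
    by apply: even_recurrence; rewrite ?eqxx ?andbT; move: ge6 ev; clear; lia.
  by apply: odd_recurrence; rewrite ?eqxx ?andbT; move: ge6 ev; clear; lia.
- move=> ge6 od; split.
    by apply: even_recurrence; rewrite ?eqxx ?andbT; move: ge6 od; clear; lia.
  by apply: odd_recurrence; rewrite ?eqxx ?andbT; move: ge6 od; clear; lia.
- move=> e4; split; first by rewrite matrix22E; apply: even_recurrence; rewrite ?e4.
  move=> n _; apply/matrixP => i j; rewrite !mxE big_ord1 !mxE !ord1 /= addn2.
  by rewrite l2 e4 // mul0r addr0 add0r.
move=> e5; split; rewrite matrix22E.
  by apply: even_recurrence; rewrite ?e5.
by apply: odd_recurrence; rewrite ?e5.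
Qed.
End Recurrences.

(** In every case the two matrices act on all even, respectively odd, indices up
    to ell-2, so that the recurrences determine each other term by term. *)
Lemma recurrences_vector (ell : nat) : (4 <= ell)%N ->
  exists me mo (Me : 'M[int]_me) (Mo : 'M[int]_mo),
    [/\ forall i, (i.*2 <= ell - 2)%N = (i < me)%N,
        forall i, (i.*2.+1 <= ell - 2)%N = (i < mo)%N &
        forall x, recurrences ell x ->
          recurrence (even_vector x) Me /\ recurrence (odd_vector x) Mo].
Proof.
rewrite leq_eqVlt => /predU1P[<-|].
  exists 2%N, 1%N, (matrix22 1 1 1 1), (2%:M); split=> [i|i|x [_ _ h _]].
  - by clear; lia.
  - by clear; lia.
  exact: h.
rewrite leq_eqVlt => /predU1P[<-|ge6].
  exists 2%N, 2%N, (matrix22 1 1 1 2), (matrix22 2 1 1 1).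
  split=> [i|i|x [_ _ _ h]].
  - by clear; lia.
  - by clear; lia.
  exact: h.
have [od|ev] := boolP (odd ell).
  exists ((ell - 1)./2), ((ell - 1)./2), (tridiag 1 2 _), (tridiag 2 1 _).
  split=> [i|i|x [_ h _ _]].
  - by move: ge6 od; clear; lia.
  - by move: ge6 od; clear; lia.
  exact: h.
exists (ell./2), (ell./2 - 1)%N, (tridiag 1 1 _), (tridiag 2 2 _).
split=> [i|i|x [h _ _ _]].
- by move: ge6 ev; clear; lia.
- by move: ge6 ev; clear; lia.
exact: h.
Qed.

Lemma recurrences_uniq (ell : nat) (w x y : nat -> nat -> int) : (4 <= ell)%N ->
  initial_conditions ell w x -> recurrences ell x ->
  initial_conditions ell w y -> recurrences ell y ->
  forall n i, (ell - 2 <= n)%N -> (i <= ell - 2)%N -> odd i = odd n ->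
    x i n = y i n.
Proof.
move=> ge4 [x1 x2] xR [y1 y2] yR n.
have [me [mo [Me [Mo [hme hmo rec]]]]] := recurrences_vector ge4.
have [xe xo] := rec x xR. have [ye yo] := rec y yR.
have [k] := ubnP n; elim: k n => // k IH n nk i le_n il par.
have [n1|n1] := eqVneq n (ell - 1)%N; 
  first by move: par; rewrite n1 => par; rewrite x1 // y1.
have [n2|n2] := eqVneq n (ell - 2)%N.
  have oe : odd (ell - 2) = odd ell by move: ge4; clear; lia.
  by move: par; rewrite n2 oe => par; rewrite x2 // y2.
have [m en] : exists m, n = (m + 2)%N by exists (n - 2)%N; move: le_n n1 ge4; clear; lia.
have m0 : (0 < m)%N by move: le_n n1 n2 en ge4; clear; lia.
have lm : (ell - 2 <= m)%N by move: le_n n1 n2 en ge4; clear; lia.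
have mk : (m < k)%N by move: nk; rewrite en; clear; lia.
have om : odd n = odd m by rewrite en oddD addbF.
have [oi|ei] := boolP (odd i).
  have im : (i./2 < mo)%N by rewrite -hmo; move: oi il; clear; lia.
  have e2 : i = i./2.*2.+1 by move: oi; clear; lia.
  have vec : odd_vector x mo m = odd_vector y mo m.
    apply/colP => j; rewrite !mxE; apply: IH => //; first by rewrite hmo.
    by rewrite -om -par oi /= odd_double.
  have := congr1 (fun v : 'cV[int]_mo => v (Ordinal im) ord0) (xo m m0).
  rewrite vec -(yo m m0) !mxE /= -e2 -en.
  exact.
have im : (i./2 < me)%N by rewrite -hme; move: ei il; clear; lia.
have e2 : i = i./2.*2 by move: ei; clear; lia.
have vec : even_vector x me m = even_vector y me m.
  apply/colP => j; rewrite !mxE; apply: IH => //; first by rewrite hme.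
  by rewrite -om -par odd_double (negPf ei).
have := congr1 (fun v : 'cV[int]_me => v (Ordinal im) ord0) (xe m m0).
rewrite vec -(ye m m0) !mxE /= -e2 -en.
exact.
Qed.

Theorem theorem6p7 (R : realType) (ell : nat) (q : R[i])
    (ell_ge4 : (4 <= ell)%N) (q_neq0 : q != 0)
    (ord_q2 : ell.-primitive_root (q ^+ 2)) :
  let w := fun i n : nat => (cell_dim R[i] i n)%:Z in
  let l := fun i n : nat => (simple_dim q i n)%:Z in
  [/\ initial_conditions ell w l,
      recurrences ell l
    & forall x : nat -> nat -> int,
        initial_conditions ell w x -> recurrences ell x ->
        forall n i : nat, (ell - 2 <= n)%N -> (i <= ell - 2)%N ->
          odd i = odd n -> x i n = l i n].
Proof.
move=> w l; pose a : R[i] := sqrtC (- q^-1).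
have aaq : a * a * q = -1.
  by rewrite -expr2 sqrtCK mulNr mulVf.
have a_neq0 : a != 0.
  by apply/eqP => a0; move/eqP: aaq; rewrite a0 !mul0r eq_sym oppr_eq0 oner_eq0.
have init : initial_conditions ell w l by apply: simple_dim_initial aaq ord_q2.
have rec : recurrences ell l by apply: recurrences_simple_dim aaq ord_q2.
by split=> // x xI xR; apply: recurrences_uniq xI xR init rec.
Qed.
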